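(* Let $ML^n_p=(J^1(T,M),L)$ be a metrical multi-time Lagrange space with $\dim T=p$, $\dim M=n$, let $\Gamma=(M^{(i)}_{(\alpha)\beta},N^{(i)}_{(\alpha)j})$ be its canonical nonlinear connection and let $C\Gamma=(H^\gamma_{\alpha\beta},G^k_{j\gamma},L^i_{jk},C^{i(\gamma)}_{j(k)})$ be its Cartan canonical connection. The torsion d-tensor $\mathbf{T}$ of $C\Gamma$ is determined by the following local components in the adapted basis (all other adapted components vanish). (i) If $p=1$, the (possibly) nonzero components are $T^m_{1j}$, $R^{(m)}_{(1)1j}$, $R^{(m)}_{(1)ij}$, $P^{(m)\;(1)}_{(1)1(j)}$, $P^{m(1)}_{i(j)}$ and $P^{(m)\;(1)}_{(1)i(j)}$, given by $$T^m_{1j}=-G^m_{j1},\qquad P^{m(1)}_{i(j)}=C^{m(1)}_{i(j)},\qquad P^{(m)\;(1)}_{(1)1(j)}=-G^m_{j1},$$ $$P^{(m)\;(1)}_{(1)i(j)}=\frac{\partial N^{(m)}_{(1)i}}{\partial y^j}-L^m_{ji},\qquad R^{(m)}_{(1)ij}=\frac{\delta N^{(m)}_{(1)i}}{\delta x^j}-\frac{\delta N^{(m)}_{(1)j}}{\delta x^i},$$ $$R^{(m)}_{(1)1j}=-\frac{\partial N^{(m)}_{(1)j}}{\partial t}+H^1_{11}\left[N^{(m)}_{(1)j}-\frac{\partial N^{(m)}_{(1)j}}{\partial y^k}y^k\right].$$ (ii) If $p\geq2$, the (possibly) nonzero components are $T^m_{\alpha j}$, $R^{(m)}_{(\mu)\alpha\beta}$,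 $R^{(m)}_{(\mu)\alpha j}$, $R^{(m)}_{(\mu)ij}$ and $P^{(m)\;(\beta)}_{(\mu)\alpha(j)}$. Denoting $$F^m_{i(\mu)}=\frac{g^{mq}}2\left[\frac{\partial g_{qi}}{\partial t^\mu}+\frac12h_{\mu\beta}U^{(\beta)}_{(q)i}\right],$$ $$H^\gamma_{\mu\alpha\beta}=\frac{\partial H^\gamma_{\mu\alpha}}{\partial t^\beta}-\frac{\partial H^\gamma_{\mu\beta}}{\partial t^\alpha}+H^\eta_{\mu\alpha}H^\gamma_{\eta\beta}-H^\eta_{\mu\beta}H^\gamma_{\eta\alpha},$$ $$r^m_{qij}=\frac{\partial\Gamma^m_{qi}}{\partial x^j}-\frac{\partial\Gamma^m_{qj}}{\partial x^i}+\Gamma^k_{qi}\Gamma^m_{kj}-\Gamma^k_{qj}\Gamma^m_{ki},$$ they are given by $$T^m_{\alpha j}=-G^m_{j\alpha},\qquad P^{(m)\;(\beta)}_{(\mu)\alpha(j)}=-\delta^\beta_\mu G^m_{j\alpha},\qquad R^{(m)}_{(\mu)\alpha\beta}=-H^\gamma_{\mu\alpha\beta}x^m_\gamma,$$ $$R^{(m)}_{(\mu)\alpha j}=-\frac{\partial N^{(m)}_{(\mu)j}}{\partial t^\alpha}+\frac{g^{mk}}2H^\beta_{\mu\alpha}\left[\frac{\partial g_{jk}}{\partial t^\beta}+\frac{h_{\beta\gamma}}2U^{(\gamma)}_{(k)j}\right],$$ $$R^{(m)}_{(\mu)ij}=r^m_{kij}x^k_\mu+\left[F^m_{i(\mu)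|j}-F^m_{j(\mu)|i}\right].$$
   Context: Greek indices run from $1$ to $p$, Latin indices from $1$ to $n$; repeated indices are summed. $T$ has local coordinates $(t^\alpha)$, $M$ has local coordinates $(x^i)$, and $E=J^1(T,M)\to T\times M$ is the first-order jet bundle with induced coordinates $(t^\alpha,x^i,x^i_\alpha)$, which change by $\tilde t^\alpha=\tilde t^\alpha(t^\beta)$, $\tilde x^i=\tilde x^i(x^j)$, $\tilde x^i_\alpha=\frac{\partial\tilde x^i}{\partial x^j}\frac{\partial t^\beta}{\partial\tilde t^\alpha}x^j_\beta$. When $p=1$ one writes $t=t^1$, $y^i=x^i_1$. $h=(h_{\alpha\beta}(t))$ is a fixed semi-Riemannian metric on $T$ with inverse $(h^{\alpha\beta})$ and Christoffel symbols $H^\gamma_{\alpha\beta}$. A d-tensor is a family of local functions on $E$ transforming tensorially under these coordinate changes. Metrical multi-time Lagrange space: a pair $(J^1(T,M),L)$ with $L:E\to\mathbb{R}$ smooth and Kronecker $h$-regular, i.e. $\frac12\frac{\partial^2L}{\partial x^i_\alpha\partial x^j_\beta}=h^{\alpha\beta}(t^\gamma)g_{ij}(t^\gamma,x^k,x^k_\gamma)$ with $g_{ij}$ a symmetric d-tensor of rank $n$ and constant signature; $(g^{ij})$ is the inverse of $(g_{ij})$. If $p\geq2$, necessarily $L=h^{\alpha\beta}(t)g_{ij}(t,x)x^i_\alpha x^j_\beta+U^{(\alpha)}_{(i)}(t,x)x^i_\alpha+F(t,x)$ with $U$ a d-tensor and $F$ a smooth function on $T\times M$; put $U^{(\alpha)}_{(i)j}=\frac{\partial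 U^{(\alpha)}_{(i)}}{\partial x^j}-\frac{\partial U^{(\alpha)}_{(j)}}{\partial x^i}$ and $\Gamma^l_{jk}=\frac{g^{li}}2\left(\frac{\partial g_{ij}}{\partial x^k}+\frac{\partial g_{ik}}{\partial x^j}-\frac{\partial g_{jk}}{\partial x^i}\right)$. Canonical nonlinear connection $\Gamma=(M^{(i)}_{(\alpha)\beta},N^{(i)}_{(\alpha)j})$: $M^{(i)}_{(\alpha)\beta}=-H^\gamma_{\alpha\beta}x^i_\gamma$ (for $p=1$: $-H^1_{11}y^i$), and $$N^{(i)}_{(\alpha)j}=\begin{cases}h_{11}\dfrac{\partial\mathcal{G}^i}{\partial y^j},&p=1\\[2mm]\Gamma^i_{jk}x^k_\alpha+\dfrac{g^{ik}}2\dfrac{\partial g_{jk}}{\partial t^\alpha}+\dfrac{g^{ik}}4h_{\alpha\gamma}U^{(\gamma)}_{(k)j},&p\geq2,\end{cases}$$ where for $p=1$: $\mathcal{G}^i=\frac{g^{ik}}4\left[\frac{\partial^2L}{\partial x^j\partial y^k}y^j-\frac{\partial L}{\partial x^k}+\frac{\partial^2L}{\partial t\partial y^k}+\frac{\partial L}{\partial y^k}H^1_{11}+2h^{11}H^1_{11}g_{kl}y^l\right]$. Adapted basis: $\frac{\delta}{\delta t^\alpha}=\frac{\partial}{\partial t^\alpha}-M^{(j)}_{(\beta)\alpha}\frac{\partial}{\partial x^j_\beta}$, $\frac{\delta}{\delta x^i}=\frac{\partial}{\partial x^i}-N^{(j)}_{(\beta)i}\frac{\partial}{\partial x^j_\beta}$,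 $\frac{\partial}{\partial x^i_\alpha}$. The Cartan canonical connection $C\Gamma=(H^\gamma_{\alpha\beta},G^k_{j\gamma},L^i_{jk},C^{i(\gamma)}_{j(k)})$ is the linear connection $\nabla$ on $E$ given by $$\nabla_{\frac{\delta}{\delta t^\gamma}}\tfrac{\delta}{\delta t^\beta}=H^\alpha_{\beta\gamma}\tfrac{\delta}{\delta t^\alpha},\quad \nabla_{\frac{\delta}{\delta t^\gamma}}\tfrac{\delta}{\delta x^i}=G^k_{i\gamma}\tfrac{\delta}{\delta x^k},\quad \nabla_{\frac{\delta}{\delta t^\gamma}}\tfrac{\partial}{\partial x^i_\beta}=(\delta^\beta_\alpha G^k_{i\gamma}-\delta^k_iH^\beta_{\alpha\gamma})\tfrac{\partial}{\partial x^k_\alpha},$$ $$\nabla_{\frac{\delta}{\delta x^j}}\tfrac{\delta}{\delta t^\beta}=0,\quad \nabla_{\frac{\delta}{\delta x^j}}\tfrac{\delta}{\delta x^i}=L^k_{ij}\tfrac{\delta}{\delta x^k},\quad \nabla_{\frac{\delta}{\delta x^j}}\tfrac{\partial}{\partial x^i_\beta}=L^k_{ij}\tfrac{\partial}{\partial x^k_\beta},$$ $$\nabla_{\frac{\partial}{\partial x^j_\gamma}}\tfrac{\delta}{\delta t^\beta}=0,\quad \nabla_{\frac{\partial}{\partial x^j_\gamma}}\tfrac{\delta}{\delta x^i}=C^{k(\gamma)}_{i(j)}\tfrac{\delta}{\delta x^k},\quad \nabla_{\frac{\partial}{\partial x^j_\gamma}}\tfrac{\partial}{\partial x^i_\beta}=C^{k(\gamma)}_{i(j)}\tfrac{\partial}{\partial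 x^k_\beta},$$ with $$G^k_{j\gamma}=\frac{g^{ki}}2\frac{\delta g_{ij}}{\delta t^\gamma},\quad L^i_{jk}=\frac{g^{im}}2\left(\frac{\delta g_{jm}}{\delta x^k}+\frac{\delta g_{km}}{\delta x^j}-\frac{\delta g_{jk}}{\delta x^m}\right),\quad C^{i(\gamma)}_{j(k)}=\frac{g^{im}}2\left(\frac{\partial g_{jm}}{\partial x^k_\gamma}+\frac{\partial g_{km}}{\partial x^j_\gamma}-\frac{\partial g_{jk}}{\partial x^m_\gamma}\right).$$ Torsion components: with $\mathbf{T}(X,Y)=\nabla_XY-\nabla_YX-[X,Y]$, the local components named in the claim are the coefficients in $$\mathbf{T}\left(\tfrac{\delta}{\delta t^\beta},\tfrac{\delta}{\delta t^\alpha}\right)=R^{(m)}_{(\mu)\alpha\beta}\tfrac{\partial}{\partial x^m_\mu},\qquad \mathbf{T}\left(\tfrac{\delta}{\delta x^j},\tfrac{\delta}{\delta t^\alpha}\right)=T^m_{\alpha j}\tfrac{\delta}{\delta x^m}+R^{(m)}_{(\mu)\alpha j}\tfrac{\partial}{\partial x^m_\mu},$$ $$\mathbf{T}\left(\tfrac{\delta}{\delta x^j},\tfrac{\delta}{\delta x^i}\right)=T^m_{ij}\tfrac{\delta}{\delta x^m}+R^{(m)}_{(\mu)ij}\tfrac{\partial}{\partial x^m_\mu},\qquad \mathbf{T}\left(\tfrac{\partial}{\partial x^j_\beta},\tfrac{\delta}{\delta t^\alpha}\right)=P^{(m)\;(\beta)}_{(\mu)\alpha(j)}\tfrac{\partial}{\partial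 x^m_\mu},$$ $$\mathbf{T}\left(\tfrac{\partial}{\partial x^j_\beta},\tfrac{\delta}{\delta x^i}\right)=P^{m(\beta)}_{i(j)}\tfrac{\delta}{\delta x^m}+P^{(m)\;(\beta)}_{(\mu)i(j)}\tfrac{\partial}{\partial x^m_\mu},\qquad \mathbf{T}\left(\tfrac{\partial}{\partial x^j_\beta},\tfrac{\partial}{\partial x^i_\alpha}\right)=S^{(m)(\alpha)(\beta)}_{(\mu)(i)(j)}\tfrac{\partial}{\partial x^m_\mu}.$$ For $p\geq2$, $F^m_{i(\mu)|j}$ is the $M$-horizontal covariant derivative: $F^m_{i(\mu)|j}=\frac{\delta F^m_{i(\mu)}}{\delta x^j}+F^k_{i(\mu)}L^m_{kj}-F^m_{k(\mu)}L^k_{ij}$. *)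

(* Defs.v *)
From HB Require Import structures.
From mathcomp Require Import all_boot all_order all_algebra.
From mathcomp Require Import all_classical all_reals topology normedtype derive.

Set Implicit Arguments.
Unset Strict Implicit.
Unset Printing Implicit Defensive.

Import Order.TTheory GRing.Theory Num.Theory.
Import numFieldNormedType.Exports.

Local Open Scope classical_set_scope.
Local Open Scope ring_scope.

(* Local functions, tensors and vector fields are total functions on the
   coordinate space; only their values on the (open) coordinate domain matter,
   and all the differential operators below are local. *)

Section Smoothness.
Context (R : realType) (V W : normedModType R).

Fixpoint differentiable_upto (k : nat) (A : set V) (f : V -> W) : Prop :=
  if k is k'.+1 then
    (forall z, A z -> differentiable f z) /\
    (forall v, differentiable_upto k' A (fun z => 'D_v f z))
  else True.

(* C^oo on an open subset of a finite-dimensional space: all iterated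
   directional derivatives exist and are Frechet differentiable (hence
   continuous). *)
Definition smooth_on (A : set V) (f : V -> W) : Prop :=
  forall k, differentiable_upto k A f.

End Smoothness.

(* Sylvester normal form with q entries -1 and m - q entries +1; such an A is
   symmetric of rank m. *)
Definition has_index (R : realType) (m q : nat) (A : 'M[R]_m) : Prop :=
  exists2 P : 'M[R]_m, P \in unitmx &
    A = P^T *m diag_mx (\row_(i < m) (if (i < q)%N then -1 else 1)) *m P.

(* A manifold of dimension m presented by an atlas. Inverse charts are not
   part of the data; [trans c c'] is the change of coordinates
   (x^i) |-> (x~^i), meaningful on [coord c @` (dom c `&` dom c')]. *)
Record smooth_manifold (R : realType) (m : nat) := SmoothManifold {
  manifold_points :> topologicalType ;
  manifold_hausdorff : hausdorff_space manifold_points ;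
  manifold_second_countable : @second_countable manifold_points ;
  chart : Type ;
  dom : chart -> set manifold_points ;
  coord : chart -> manifold_points -> 'rV[R]_m ;
  trans : chart -> chart -> 'rV[R]_m -> 'rV[R]_m ;
  dom_cover : forall x, exists c, dom c x ;
  coord_inj : forall c, {in dom c &, injective (coord c)} ;
  coord_continuous : forall c (W : set 'rV[R]_m), open W ->
    open (dom c `&` coord c @^-1` W) ;
  coord_open : forall c (O : set manifold_points), open O -> O `<=` dom c ->
    open (coord c @` O) ;
  transE : forall c c' x, dom c x -> dom c' x ->
    trans c c' (coord c x) = coord c' x ;
  trans_smooth : forall c c',
    smooth_on (coord c @` (dom c `&` dom c')) (trans c c') }.

Arguments chart {R m} _.
Arguments dom {R m _} _ _.
Arguments coord {R m _} _ _.
Arguments trans {R m _} _ _ _.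

Section Manifolds.
Context (R : realType) (m : nat) (X : smooth_manifold R m).

(* d x~^i / d x^j at the point x *)
Definition dcoord (c c' : chart X) (x : X) (i j : 'I_m) : R :=
  ('D_(delta_mx 0 j) (trans c c') (coord c x)) 0 i.

Definition semi_Riemannian_metric (h : chart X -> 'rV[R]_m -> 'M[R]_m) : Prop :=
  [/\ forall c, smooth_on (coord c @` dom c) (h c),
      forall c x, dom c x -> (h c (coord c x))^T = h c (coord c x),
      exists q, forall c x, dom c x -> has_index q (h c (coord c x)) &
      forall c c' x (a b : 'I_m), dom c x -> dom c' x ->
        h c (coord c x) a b =
        \sum_(k < m) \sum_(l < m)
          dcoord c c' x k a * dcoord c c' x l b * h c' (coord c' x) k l].

End Manifolds.

(* Coordinates (t^alpha, x^i, x^i_alpha) on the jet bundle: z.1.1, z.1.2 and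
   z.2, with x^i_alpha = z.2 i alpha. This is also the type of the components
   of tangent vectors of the jet bundle. *)
Definition jet_coords (R : realType) (p n : nat) : normedModType R :=
  ('rV[R]_p * 'rV[R]_n * 'M[R]_(n, p))%type.

Section JetBundle.
Context (R : realType) (p n : nat).
Context (T : smooth_manifold R p) (M : smooth_manifold R n).

(* A 1-jet at (t, x), given by its fibre coordinates in every pair of charts
   around t and x (and by 0 for the other pairs, so that equal jets are equal
   elements of this type). *)
Record jet := Jet {
  jet_src : T ;
  jet_tgt : M ;
  jet_fibre : chart T -> chart M -> 'M[R]_(n, p) ;
  jet_fibre_out : forall c d, ~ (dom c jet_src /\ dom d jet_tgt) ->
    jet_fibre c d = 0 ;
  jet_change : forall c c' d d' (i : 'I_n) (a : 'I_p),
    dom c jet_src -> dom c' jet_src -> dom d jet_tgt -> dom d' jet_tgt ->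
    jet_fibre c' d' i a =
    \sum_(j < n) \sum_(b < p)
      dcoord d d' jet_tgt i j * dcoord c' c jet_src b a * jet_fibre c d j b }.

Definition jet_dom (c : chart T) (d : chart M) : set jet :=
  [set e | dom c (jet_src e) /\ dom d (jet_tgt e)].

Definition jet_coord (c : chart T) (d : chart M) (e : jet) : jet_coords R p n :=
  (coord c (jet_src e), coord d (jet_tgt e), jet_fibre e c d).

Definition jet_range (c : chart T) (d : chart M) : set (jet_coords R p n) :=
  [set z | (coord c @` dom c) z.1.1 /\ (coord d @` dom d) z.1.2].

(* Every point of [jet_range c d] is the coordinate vector of exactly one jet,
   whose image by L is the value chosen here. *)
Definition local_expr (L : jet -> R) (c : chart T) (d : chart M)
    (z : jet_coords R p n) : R :=
  xget 0 [set r | exists e, [/\ jet_dom c d e, jet_coord c d e = z & L e = r]].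

(* A symmetric d-tensor g_ij of rank n and constant signature. *)
Definition metric_dtensor
    (g : chart T -> chart M -> jet_coords R p n -> 'M[R]_n) : Prop :=
  [/\ forall c d, smooth_on (jet_range c d) (g c d),
      forall c d z, jet_range c d z -> (g c d z)^T = g c d z,
      exists q, forall c d z, jet_range c d z -> has_index q (g c d z) &
      forall c c' d d' e (i j : 'I_n), jet_dom c d e -> jet_dom c' d' e ->
        g c d (jet_coord c d e) i j =
        \sum_(k < n) \sum_(l < n)
          dcoord d d' (jet_tgt e) k i * dcoord d d' (jet_tgt e) l j
          * g c' d' (jet_coord c' d' e) k l].

End JetBundle.

Section LocalGeometry.
Context (R : realType) (p n : nat).
Local Notation E := (jet_coords R p n).
Local Notation vfield := (E -> E).

(* d/dt^alpha, d/dx^i, d/dx^i_alpha *)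
Definition ddt (a : 'I_p) : vfield := fun _ => (delta_mx 0 a, 0, 0).
Definition ddx (i : 'I_n) : vfield := fun _ => (0, delta_mx 0 i, 0).
Definition ddv (i : 'I_n) (a : 'I_p) : vfield := fun _ => (0, 0, delta_mx i a).

Definition along (W : normedModType R) (X : vfield) (f : E -> W) : E -> W :=
  fun z => 'D_(X z) f z.

Definition bracket (X Y : vfield) : vfield :=
  fun z => along X Y z - along Y X z.

(* (G^{im} / 2) (X_k G_jm + X_j G_km - X_m G_jk), G^{im} inverse to G_im *)
Definition christoffel (m : nat) (X : 'I_m -> vfield) (G : E -> 'M[R]_m)
    (i j k : 'I_m) : E -> R :=
  fun z => \sum_(l < m) invmx (G z) i l / 2 *
    (along (X k) (fun w => G w j l) z + along (X j) (fun w => G w k l) z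
     - along (X l) (fun w => G w j k) z).

Definition linear_connection (A : set E) (nabla : vfield -> vfield -> vfield) :
    Prop :=
  [/\ forall X Y, smooth_on A X -> smooth_on A Y -> smooth_on A (nabla X Y),
      forall X X' Y, smooth_on A X -> smooth_on A X' -> smooth_on A Y ->
        forall z, A z ->
        nabla (fun w => X w + X' w) Y z = nabla X Y z + nabla X' Y z,
      forall (f : E -> R) X Y, smooth_on A f -> smooth_on A X -> smooth_on A Y ->
        forall z, A z ->
        nabla (fun w => f w *: X w) Y z = f z *: nabla X Y z,
      forall X Y Y', smooth_on A X -> smooth_on A Y -> smooth_on A Y' ->
        forall z, A z ->
        nabla X (fun w => Y w + Y' w) z = nabla X Y z + nabla X Y' z &
      forall (f : E -> R) X Y, smooth_on A f -> smooth_on A X -> smooth_on A Y ->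
        forall z, A z ->
        nabla X (fun w => f w *: Y w) z
          = along X f z *: Y z + f z *: nabla X Y z].

Definition torsion (nabla : vfield -> vfield -> vfield) (X Y : vfield) : vfield :=
  fun z => nabla X Y z - nabla Y X z - bracket X Y z.

(* A is the range of the chart, h is pulled back from T to the jet bundle and
   L, g are the local expressions of the Lagrangian and of g_ij. *)
Context (A : set E) (h : E -> 'M[R]_p) (L : E -> R) (g : E -> 'M[R]_n).

Definition Kronecker_regular : Prop :=
  forall z (i j : 'I_n) (a b : 'I_p), A z ->
    2^-1 * along (ddv i a) (along (ddv j b) L) z = invmx (h z) a b * g z i j.

(* H^c_ab and Gamma^l_jk *)
Definition Chr_t (c a b : 'I_p) : E -> R := christoffel ddt h c a b.
Definition Chr_x (l j k : 'I_n) : E -> R := christoffel ddx g l j k.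

Definition affine_part (U : 'rV[R]_p * 'rV[R]_n -> 'M[R]_(n, p))
    (F : 'rV[R]_p * 'rV[R]_n -> R) : Prop :=
  forall z, A z -> L z =
    \sum_(i < n) \sum_(j < n) \sum_(a < p) \sum_(b < p)
       invmx (h z) a b * g z i j * z.2 i a * z.2 j b
    + \sum_(i < n) \sum_(a < p) U z.1 i a * z.2 i a + F z.1.

(* The tensor U^(a)_(i)(t, x) of L = h^ab g_ij x^i_a x^j_b + U^(a)_(i) x^i_a + F.
   When p >= 2 a Kronecker h-regular L has this form with a unique U and F over
   A; for p = 1 the definition is not used. *)
Definition Utensor : 'rV[R]_p * 'rV[R]_n -> 'M[R]_(n, p) :=
  xget (fun _ => 0) [set U | exists F, affine_part U F].

(* U^(a)_(i)j *)
Definition Ucurl (a : 'I_p) (i j : 'I_n) : E -> R :=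
  fun z => along (ddx j) (fun w => Utensor w.1 i a) z
         - along (ddx i) (fun w => Utensor w.1 j a) z.

(* M^(i)_(a)b *)
Definition Mcan (i : 'I_n) (a b : 'I_p) : E -> R :=
  fun z => - \sum_(c < p) Chr_t c a b z * z.2 i c.

(* The spray G^i of the case p = 1, where a stands for the only index 1. *)
Definition spray (a : 'I_p) (i : 'I_n) : E -> R :=
  fun z => \sum_(k < n) invmx (g z) i k / 4 *
    (\sum_(j < n) along (ddx j) (along (ddv k a) L) z * z.2 j a
     - along (ddx k) L z
     + along (ddt a) (along (ddv k a) L) z
     + along (ddv k a) L z * Chr_t a a a z
     + 2 * invmx (h z) a a * Chr_t a a a z * \sum_(l < n) g z k l * z.2 l a).

(* N^(i)_(a)j *)
Definition Ncan (i : 'I_n) (a : 'I_p) (j : 'I_n) : E -> R :=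
  fun z =>
    if p == 1%N then h z a a * along (ddv j a) (spray a i) z
    else \sum_(k < n) Chr_x i j k z * z.2 k a
         + \sum_(k < n) invmx (g z) i k / 2 * along (ddt a) (fun w => g w j k) z
         + \sum_(k < n) \sum_(c < p)
             invmx (g z) i k / 4 * h z a c * Ucurl c k j z.

(* delta/delta t^a and delta/delta x^i *)
Definition delt (a : 'I_p) : vfield :=
  fun z => ddt a z - \sum_(j < n) \sum_(b < p) Mcan j b a z *: ddv j b z.
Definition delx (i : 'I_n) : vfield :=
  fun z => ddx i z - \sum_(j < n) \sum_(b < p) Ncan j b i z *: ddv j b z.

(* G^k_jc, L^i_jk and C^i(c)_j(k) *)
Definition Gcf (k j : 'I_n) (c : 'I_p) : E -> R :=
  fun z => \sum_(i < n) invmx (g z) k i / 2 * along (delt c) (fun w => g w i j) z.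
Definition Lcf (i j k : 'I_n) : E -> R := christoffel delx g i j k.
Definition Ccf (i j : 'I_n) (c : 'I_p) (k : 'I_n) : E -> R :=
  christoffel (fun m => ddv m c) g i j k.

Definition Cartan_connection (nabla : vfield -> vfield -> vfield) : Prop :=
  linear_connection A nabla /\
  forall z, A z ->
  [/\ [/\ forall b c, nabla (delt c) (delt b) z
            = \sum_(a < p) Chr_t a b c z *: delt a z,
          forall i c, nabla (delt c) (delx i) z
            = \sum_(k < n) Gcf k i c z *: delx k z &
          forall i b c, nabla (delt c) (ddv i b) z
            = \sum_(k < n) \sum_(a < p)
                ((b == a)%:R * Gcf k i c z - (k == i)%:R * Chr_t b a c z)
                *: ddv k a z],
      [/\ forall j b, nabla (delx j) (delt b) z = 0,
          forall i j, nabla (delx j) (delx i) z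
            = \sum_(k < n) Lcf k i j z *: delx k z &
          forall i j b, nabla (delx j) (ddv i b) z
            = \sum_(k < n) Lcf k i j z *: ddv k b z] &
      [/\ forall j b c, nabla (ddv j c) (delt b) z = 0,
          forall i j c, nabla (ddv j c) (delx i) z
            = \sum_(k < n) Ccf k i c j z *: delx k z &
          forall i j b c, nabla (ddv j c) (ddv i b) z
            = \sum_(k < n) Ccf k i c j z *: ddv k b z]].

(* F^m_i(a) and its M-horizontal covariant derivative F^m_i(a)|j *)
Definition Ften (m i : 'I_n) (a : 'I_p) : E -> R :=
  fun z => \sum_(q < n) invmx (g z) m q / 2 *
    (along (ddt a) (fun w => g w q i) z
     + 2^-1 * \sum_(b < p) h z a b * Ucurl b q i z).
Definition Fcov (m i : 'I_n) (a : 'I_p) (j : 'I_n) : E -> R :=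
  fun z => along (delx j) (Ften m i a) z
    + \sum_(k < n) Ften k i a z * Lcf m k j z
    - \sum_(k < n) Ften m k a z * Lcf k i j z.

(* K^m_qij = X_j Gamma^m_qi - X_i Gamma^m_qj
             + Gamma^k_qi Gamma^m_kj - Gamma^k_qj Gamma^m_ki *)
Definition curvature (r : nat) (X : 'I_r -> vfield)
    (Gam : 'I_r -> 'I_r -> 'I_r -> E -> R) (m q i j : 'I_r) : E -> R :=
  fun z => along (X j) (Gam m q i) z - along (X i) (Gam m q j) z
    + \sum_(k < r) Gam k q i z * Gam m k j z
    - \sum_(k < r) Gam k q j z * Gam m k i z.

(* H^c_mab and r^m_qij *)
Definition Curv_t : 'I_p -> 'I_p -> 'I_p -> 'I_p -> E -> R :=
  curvature ddt Chr_t.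
Definition Curv_x : 'I_n -> 'I_n -> 'I_n -> 'I_n -> E -> R :=
  curvature ddx Chr_x.

End LocalGeometry.

Section LagrangeSpace.
Context (R : realType) (p n : nat).
Context (T : smooth_manifold R p) (M : smooth_manifold R n).

Definition Lagrange_space (h : chart T -> 'rV[R]_p -> 'M[R]_p)
    (L : jet T M -> R)
    (g : chart T -> chart M -> jet_coords R p n -> 'M[R]_n) : Prop :=
  [/\ semi_Riemannian_metric h,
      forall c d, smooth_on (jet_range c d) (local_expr L c d),
      metric_dtensor g &
      forall c d, Kronecker_regular (jet_range c d) (fun z => h c z.1.1)
                    (local_expr L c d) (g c d)].

End LagrangeSpace.

(* Main.v *)
Require Import Defs.
From HB Require Import structures.
From mathcomp Require Import all_boot all_order all_algebra.
From mathcomp Require Import all_classical all_reals topology normedtype landau derive.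
From mathcomp Require Import ring.

Set Implicit Arguments.
Unset Strict Implicit.
Unset Printing Implicit Defensive.

Import Order.TTheory GRing.Theory Num.Theory.
Import numFieldNormedType.Exports.

Local Open Scope classical_set_scope.
Local Open Scope ring_scope.

(* The adapted fields differ from the coordinate fields by vertical ones:
   delta/delta t and delta/delta x have the form e - sum m_jb d/dx^j_b with e
   constant.  Hence their brackets are vertical, with coefficients Y m - X m',
   and every torsion component is a coefficient of the connection plus such a
   difference.

   For p >= 2 the third vertical derivatives of L are symmetric, which forces
   g_ij to be independent of the fibre coordinates.  Then L^i_jk = Gamma^i_jk,
   C = 0, and N^(m)_(mu)i = Gamma^m_ik x^k_mu + F^m_i(mu) is affine on the
   fibres with coefficients living on T x M, so that its adapted derivatives can
   be computed explicitly. *)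

(** * Smooth functions on open sets *)

(** Expanding a derivative along delta/delta t or delta/delta x uses linearity in the direction,
    hence Frechet differentiability of the function at hand, in particular of M and N. Their
    coefficients contain entries of inverse matrices, derivatives of [L] and, for p >= 2, the tensor
    U, which is only a chosen solution of an equation: its smoothness has to be recovered from [L].
    Facts such as the symmetry of [g] hold on [A] only, so they may be used under a derivative only
    because [A] is open. Independence of some coordinates is expressed as invariance under
    translations, since this passes to difference quotients and hence to derivatives. That vertical
    translations stay in [A] is due to [A] containing whole fibres. For p = 1 the torsion formulas
    keep N as it stands; only its smoothness and the form M = - H y enter. *)

(** The first-order expansion of [f] at [x] involves nearby points only, so it is also an expansion
    of [g], and uniqueness of the differential identifies ['d g x] with ['d f x]. *)
Lemma near_eq_differentiable (R : realType) (V W : normedModType R)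
    (f g : V -> W) (x : V) :
  {near x, f =1 g} -> differentiable f x -> differentiable g x.
Proof.
move=> fg df.
have fgx : f x = g x by exact: nbhs_singleton fg.
have E : g \o shift x = cst (g x) + 'd f x +o_ 0 id.
  apply/eqaddoP => e e0.
  have /eqaddoP/(_ e e0) := diff_locally df.
  have : \forall h \near (0 : V), f (h + x) = g (h + x).
    by move: (fg : \forall w \near x, f w = g w); rewrite (near_shift 0) subr0.
  by apply: filterS2 => h gh; rewrite !fctE /= -gh fgx.
have dc : continuous ('d f x) by exact: diff_continuous.
by apply/diff_locallyP; rewrite (diff_unique dc E).
Qed.

Section SmoothOn.
Context (R : realType) (V : normedModType R) (A : set V).
Hypothesis oA : open A.

Section VectorValued.
Context (W : normedModType R).
Implicit Types f g : V -> W.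

Lemma near_open f g z : (forall w, A w -> f w = g w) -> A z ->
  {near z, f =1 g}.
Proof. by move=> fg Az; apply: filterS fg _; exact: open_nbhs_nbhs. Qed.

Lemma derive_ext f g v z : (forall w, A w -> f w = g w) -> A z ->
  'D_v f z = 'D_v g z.
Proof. by move=> fg Az; apply: near_eq_derive; exact: near_open. Qed.

Lemma differentiable_upto_ext k f g : (forall z, A z -> f z = g z) ->
  differentiable_upto k A f -> differentiable_upto k A g.
Proof.
elim: k f g => //= k IH f g fg [df Df]; split=> [z Az|v].
  by apply: near_eq_differentiable (df z Az); exact: near_open.
by apply: IH (Df v) => z Az; exact: derive_ext.
Qed.

Lemma differentiable_uptoW k f :
  differentiable_upto k.+1 A f -> differentiable_upto k A f.
Proof. by elim: k f => // k IH f [df Df]; split=> // v; exact/IH/Df. Qed.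

Lemma differentiable_upto_cst k (c : W) : differentiable_upto k A (cst c).
Proof.
elim: k c => //= k IH c; split=> [z _|v]; first exact: differentiable_cst.
by apply: differentiable_upto_ext (IH 0) => z _; rewrite derive_cst.
Qed.

Lemma differentiable_uptoD k f g : differentiable_upto k A f ->
  differentiable_upto k A g -> differentiable_upto k A (fun z => f z + g z).
Proof.
elim: k f g => //= k IH f g [df Df] [dg Dg]; split=> [z Az|v].
  by apply: differentiableD; [exact: df|exact: dg].
apply: differentiable_upto_ext (IH _ _ (Df v) (Dg v)) => z Az.
by rewrite deriveD//; apply: diff_derivable; [exact: df|exact: dg].
Qed.

Lemma smooth_on_ext f g : (forall z, A z -> f z = g z) ->
  smooth_on A f -> smooth_on A g.
Proof. by move=> fg sf k; exact: differentiable_upto_ext fg (sf k). Qed.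

Lemma smooth_on_differentiable f z : smooth_on A f -> A z ->
  differentiable f z.
Proof. by move=> /(_ 1%N)[df _]; exact: df. Qed.

Lemma smooth_on_derive f v : smooth_on A f -> smooth_on A ('D_v f).
Proof. by move=> sf k; have [_] := sf k.+1; apply. Qed.

End VectorValued.

(** A continuous linear map commutes with directional derivatives, so the induction meets only
    functions of the form [phi \o _]. *)
Lemma differentiable_upto_lin (W W' : normedModType R)
    (phi : {linear W -> W'}) k (f : V -> W) :
  continuous phi -> differentiable_upto k A f ->
  differentiable_upto k A (phi \o f).
Proof.
move=> cphi; elim: k f => //= k IH f [df Df].
have dphi w : differentiable phi w by exact: linear_differentiable.
have dc z Az := differentiable_comp (df z Az) (dphi (f z)).
split=> // v.
have E z : A z -> phi ('D_v f z) = 'D_v (phi \o f) z.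
  move=> Az; rewrite (deriveE _ (df z Az)) (deriveE _ (dc z Az)).
  by rewrite (diff_comp (df z Az) (dphi _)) /= diff_lin.
by apply: (differentiable_upto_ext (f := phi \o 'D_v f) E); exact/IH/Df.
Qed.

Lemma differentiable_uptoM k (f g : V -> R) : differentiable_upto k A f ->
  differentiable_upto k A g -> differentiable_upto k A (fun z => f z * g z).
Proof.
elim: k f g => // k IH f g sf sg.
(* The product rule leaves one factor undifferentiated, and the induction hypothesis wants it at the
   lower order [k]. *)
have f' := differentiable_uptoW sf; have g' := differentiable_uptoW sg.
move: sf sg => [df Df] [dg Dg]; split=> [z Az|v].
  by apply: differentiableM; [exact: df|exact: dg].
apply: differentiable_upto_ext
  (differentiable_uptoD (IH _ _ f' (Dg v)) (IH _ _ g' (Df v))) => z Az.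
by rewrite deriveM//; apply: diff_derivable; [exact: df|exact: dg].
Qed.

(** The derivative is - f^-1 * f^-1 * f', where f^-1 has order [k] by induction, so closure under
    products finishes. *)
Lemma differentiable_uptoV k (f : V -> R) : (forall z, A z -> f z != 0) ->
  differentiable_upto k A f -> differentiable_upto k A (fun z => (f z)^-1).
Proof.
move=> f0; elim: k => // k IH sf.
have f' := IH (differentiable_uptoW sf).
move: sf => [df Df]; split=> [z Az|v].
  by apply: differentiableV; [exact: df|exact: f0].
have c1 : differentiable_upto k A (cst (-1 : R)).
  exact: differentiable_upto_cst.
have := differentiable_uptoM (differentiable_uptoM c1
  (differentiable_uptoM f' f')) (Df v).
apply: differentiable_upto_ext => z Az.
rewrite deriveV ?f0//; last by apply: diff_derivable; exact: df.
by rewrite /cst mulN1r -invfM -expr2.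
Qed.

Lemma smooth_on_cst (W : normedModType R) (c : W) : smooth_on A (cst c).
Proof. by move=> k; exact: differentiable_upto_cst. Qed.

Lemma smooth_onD (W : normedModType R) (f g : V -> W) :
  smooth_on A f -> smooth_on A g -> smooth_on A (fun z => f z + g z).
Proof. by move=> sf sg k; exact: differentiable_uptoD. Qed.

Lemma smooth_onM (f g : V -> R) :
  smooth_on A f -> smooth_on A g -> smooth_on A (fun z => f z * g z).
Proof. by move=> sf sg k; exact: differentiable_uptoM. Qed.

Lemma smooth_onV (f : V -> R) : (forall z, A z -> f z != 0) ->
  smooth_on A f -> smooth_on A (fun z => (f z)^-1).
Proof. by move=> f0 sf k; exact: differentiable_uptoV. Qed.

Lemma smooth_onN (f : V -> R) : smooth_on A f -> smooth_on A (fun z => - f z).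
Proof.
move=> sf; apply: smooth_on_ext (smooth_onM (smooth_on_cst (-1 : R)) sf) => z _.
by rewrite /cst mulN1r.
Qed.

Lemma smooth_onB (f g : V -> R) :
  smooth_on A f -> smooth_on A g -> smooth_on A (fun z => f z - g z).
Proof. by move=> sf sg; exact: smooth_onD sf (smooth_onN sg). Qed.

Lemma smooth_on_sum I (r : seq I) (P : pred I) (F : I -> V -> R) :
  (forall i, P i -> smooth_on A (F i)) ->
  smooth_on A (fun z => \sum_(i <- r | P i) F i z).
Proof.
move=> sF; elim: r => [|i r IH].
  by apply: smooth_on_ext (smooth_on_cst (0 : R)) => z _; rewrite big_nil.
case Pi: (P i); last first.
  by apply: smooth_on_ext IH => z _; rewrite big_cons Pi.
apply: smooth_on_ext (smooth_onD (sF i Pi) IH) => z _.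
by rewrite big_cons Pi.
Qed.

Lemma smooth_on_prod I (r : seq I) (P : pred I) (F : I -> V -> R) :
  (forall i, P i -> smooth_on A (F i)) ->
  smooth_on A (fun z => \prod_(i <- r | P i) F i z).
Proof.
move=> sF; elim: r => [|i r IH].
  by apply: smooth_on_ext (smooth_on_cst (1 : R)) => z _; rewrite big_nil.
case Pi: (P i); last first.
  by apply: smooth_on_ext IH => z _; rewrite big_cons Pi.
apply: smooth_on_ext (smooth_onM (sF i Pi) IH) => z _.
by rewrite big_cons Pi.
Qed.

Lemma smooth_on_entry m n (F : V -> 'M[R]_(m, n)) i j :
  smooth_on A F -> smooth_on A (fun z => F z i j).
Proof.
have @phi : {linear 'M[R]_(m, n) -> R}.
  by exists (fun N : 'M[R]_(_, _) => N i j); do 2![eexists]; do ?[constructor];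
     rewrite ?mxE// => ? *; rewrite ?mxE//; move=> ?; rewrite !mxE.
by move=> sF k; apply: (differentiable_upto_lin (phi := phi));
  [exact: coord_continuous|exact: sF].
Qed.

Lemma smooth_on_det n (F : V -> 'M[R]_n) :
  (forall i j, smooth_on A (fun z => F z i j)) ->
  smooth_on A (fun z => \det (F z)).
Proof.
move=> sF; apply: smooth_on_sum => s _; apply: smooth_onM.
  exact: (smooth_on_cst (_ : R)).
by apply: smooth_on_prod => i _; exact: sF.
Qed.

(** Cramer's rule: the entry is a cofactor divided by the determinant, and both are polynomial in
    the entries of [F]. *)
Lemma smooth_on_invmx n (F : V -> 'M[R]_n) i j :
  (forall z, A z -> F z \in unitmx) ->
  (forall i j, smooth_on A (fun z => F z i j)) ->
  smooth_on A (fun z => invmx (F z) i j).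
Proof.
move=> uF sF.
have sadj : smooth_on A (fun z => \adj (F z) i j).
  have : smooth_on A (fun z => cofactor (F z) j i).
    apply: smooth_onM; first exact: (smooth_on_cst (_ : R)).
    apply: smooth_on_det => k l.
    by apply: smooth_on_ext (sF (lift j k) (lift i l)) => z _; rewrite !mxE.
  by apply: smooth_on_ext => z _; rewrite mxE.
have d0 z : A z -> \det (F z) != 0 by move=> Az; rewrite -unitfE -unitmxE uF.
apply: smooth_on_ext (smooth_onM (smooth_onV d0 (smooth_on_det sF)) sadj).
by move=> z Az; rewrite /invmx uF// [RHS]mxE.
Qed.

End SmoothOn.

(** The differential [de] of [e] is the same at every point, so the derivative of [f \o e] along [v]
    is again a composite with [e], namely of the derivative of [f] along [de v]; this keeps the
    induction within composites. *)
Lemma differentiable_upto_comp (R : realType) (V V' W : normedModType R)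
    (A : set V) (B : set V') (e de : V' -> V) k (f : V -> W) :
  (forall z, is_diff z e de) -> (forall z, B z -> A (e z)) ->
  differentiable_upto k A f -> open B -> differentiable_upto k B (f \o e).
Proof.
move=> ede BA + oB.
have de' z : differentiable e z.
  exact: (@ex_diff _ _ _ _ _ _ _ (ede z)).
elim: k f => //= k IH f [df Df].
have dfe z : B z -> differentiable f (e z) by move=> Bz; exact/df/BA.
have dfce z Bz := differentiable_comp (de' z) (dfe z Bz).
split=> // v.
have E z : B z -> 'D_(de v) f (e z) = 'D_v (f \o e) z.
  move=> Bz; rewrite (deriveE _ (dfe z Bz)) (deriveE _ (dfce z Bz)).
  by rewrite (diff_comp (de' z) (dfe z Bz)) /= diff_val.
by apply: (differentiable_upto_ext (f := 'D_(de v) f \o e) oB E); exact/IH/Df.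
Qed.

Lemma smooth_on_comp (R : realType) (V V' W : normedModType R)
    (A : set V) (B : set V')
    (e de : V' -> V) (f : V -> W) :
  (forall z, is_diff z e de) -> (forall z, B z -> A (e z)) ->
  open B -> smooth_on A f -> smooth_on B (f \o e).
Proof.
by move=> ede BA oB sf k; apply: differentiable_upto_comp ede BA _ oB.
Qed.

(** * Symmetry of second derivatives *)

Section Translation.
Context (R : realType) (V W : normedModType R) (f : V -> W) (c u w : V).

Let growth_rate_translate :
  (fun h : R =>
     h^-1 *: (((fun x => f (x + c)) \o shift w) (h *: u) - f (w + c)))
  = (fun h => h^-1 *: ((f \o shift (w + c)) (h *: u) - f (w + c))).
Proof. by apply/funext => h /=; rewrite addrA. Qed.

(** The difference quotients are one and the same function, so the limits agree even when they are
    default values. *)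
Lemma derive_translate : 'D_u (fun x => f (x + c)) w = 'D_u f (w + c).
Proof. by rewrite /derive growth_rate_translate. Qed.

Lemma derivable_translate :
  derivable f (w + c) u -> derivable (fun x => f (x + c)) w u.
Proof. by rewrite /derivable growth_rate_translate. Qed.

End Translation.

Section Schwarz.
Context (R : realType) (V : normedModType R).

Lemma is_derive_line (f : V -> R) (w u : V) (s : R) :
  derivable f (w + s *: u) u ->
  is_derive s 1 (fun t => f (w + t *: u)) ('D_u f (w + s *: u)).
Proof.
have E : (fun h : R => h^-1 *: (((fun t => f (w + t *: u)) \o shift s) h%:A
            - f (w + s *: u))) =
    (fun h => h^-1 *: ((f \o shift (w + s *: u)) (h *: u) - f (w + s *: u))).
  apply/funext => h /=; congr (_ *: (f _ - _)).
  by rewrite [h%:A]mulr1 scalerDl addrCA.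
by move=> df; apply: DeriveDef; rewrite /derivable /derive E.
Qed.

(** Restriction to the line through [w] in direction [u] reduces this to the mean value theorem on
    [0, s]. *)
Lemma MVT_line (f : V -> R) (w u : V) (s : R) : 0 < s ->
  (forall t, 0 <= t <= s -> derivable f (w + t *: u) u) ->
  exists2 t, 0 <= t <= s & f (w + s *: u) - f w = s * 'D_u f (w + t *: u).
Proof.
move=> s0 df.
have d t : 0 <= t <= s ->
    is_derive t 1 (fun t => f (w + t *: u)) ('D_u f (w + t *: u)).
  by move=> /df; exact: is_derive_line.
have [||t] := @MVT _ (fun t => f (w + t *: u))
  (fun t => 'D_u f (w + t *: u)) _ _ s0.
- move=> t; rewrite in_itv /= => /andP[t0 ts]; apply: d.
  by rewrite !ltW.
- apply: derivable_within_continuous => t; rewrite in_itv /= => /d dt.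
  exact: (@ex_derive _ _ _ _ _ _ _ dt).
rewrite in_itv /= scale0r addr0 subr0 => /andP[t0 ts] ->.
by exists t; [rewrite !ltW|rewrite mulrC].
Qed.

Context (A : set V) (f : V -> R).
Hypotheses (oA : open A) (sf : smooth_on A f).

(** The mean value theorem is used twice: in direction [u] for the increment of [f] by [s *: v],
    then in direction [v] for the derivative of [f] along [u]. The point obtained is [z] plus
    multiples of [u] and [v] by factors in [0, s], hence lies in [N] for small [s]. *)
Lemma second_difference (u v z : V) (N : set V) : A z -> nbhs z N ->
  exists2 d : R, 0 < d & forall s : R, 0 < s < d -> exists2 w, N w &
    f (z + s *: u + s *: v) - f (z + s *: u) - f (z + s *: v) + f z
      = s * s * 'D_v ('D_u f) w.
Proof.
move=> Az Nz.
have /nbhs_ballP[r r0 zr] : nbhs z (N `&` A).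
  by apply: filterI => //; exact: open_nbhs_nbhs.
(* For a, b in [0, s] the displacement a u + b v has norm at most s K, hence less than r once s < r
   / K. The summand 1 keeps K positive when u = v = 0. *)
pose K := `|u| + `|v| + 1.
have K0 : 0 < K by rewrite ltr_wpDl// addr_ge0.
have inN (a b s : R) : 0 < s < r / K -> 0 <= a <= s -> 0 <= b <= s ->
    N (z + a *: u + b *: v) /\ A (z + a *: u + b *: v).
  move=> /andP[s0 sd] /andP[a0 as_] /andP[b0 bs]; apply: zr.
  rewrite -ball_normE /= -addrA opprD addNKr normrN.
  rewrite (le_lt_trans (ler_normD _ _))// !normrZ !ger0_norm//.
  rewrite (@le_lt_trans _ _ (s * K))// -?ltr_pdivlMr//.
  rewrite !mulrDr mulr1 ler_wpDr ?(ltW s0)// lerD// ler_wpM2r//.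
exists (r / K); first exact: divr_gt0.
move=> s sd; have /andP[s0 _] := sd.
have s00 : 0 <= (0 : R) <= s by rewrite lexx ltW.
have sss : 0 <= s <= s by rewrite lexx ltW.
pose g w := f (w + s *: v) - f w.
have df w : A w -> differentiable f w by exact: smooth_on_differentiable.
have dDf w : A w -> derivable ('D_u f) w v.
  move=> Aw; apply: diff_derivable; apply: (smooth_on_differentiable _ Aw).
  exact: smooth_on_derive.
have dg t : 0 <= t <= s -> derivable g (z + t *: u) u.
  move=> ts; have [_ A1] := inN t s s sd ts sss.
  have [_ A0] := inN t 0 s sd ts s00; rewrite scale0r addr0 in A0.
  apply: derivableB; [apply: derivable_translate|];
    exact/diff_derivable/df.
have [t ts] := MVT_line s0 dg.
have -> : 'D_u g (z + t *: u) =
    'D_u f (z + t *: u + s *: v) - 'D_u f (z + t *: u).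
  have [_ A1] := inN t s s sd ts sss.
  have [_ A0] := inN t 0 s sd ts s00; rewrite scale0r addr0 in A0.
  rewrite deriveB ?derive_translate//;
    [apply: derivable_translate|]; exact/diff_derivable/df.
have [t' ts'|t' ts' ->] := @MVT_line ('D_u f) (z + t *: u) v s s0.
  by apply: dDf; have [] := inN t t' s sd ts ts'.
rewrite /g opprB addrA addrAC => E; exists (z + t *: u + t' *: v).
  by have [] := inN t t' s sd ts ts'.
by rewrite -mulrA -E; ring.
Qed.

(** The second difference is symmetric in [u] and [v], so the two mixed derivatives agree when taken
    at two suitable points near [z]. By continuity each of them is within e / 2 of its value at
    [z]. *)
Lemma schwarz (u v z : V) : A z -> 'D_u ('D_v f) z = 'D_v ('D_u f) z.
Proof.
move=> Az; apply/eqP; rewrite -subr_eq0 -normr_le0; apply/ler_addgt0Pl => e e0.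
have e2 : 0 < e / 2 by rewrite divr_gt0.
have near_e a b : nbhs z [set w | `|'D_a ('D_b f) z - 'D_a ('D_b f) w| < e / 2].
  have : {for z, continuous ('D_a ('D_b f))}.
    apply: differentiable_continuous; apply: (smooth_on_differentiable _ Az).
    by do 2! apply: smooth_on_derive.
  by move/cvgrPdist_lt; apply.
have [d d0 Hd] := second_difference u v Az (near_e v u).
have [d' d'0 Hd'] := second_difference v u Az (near_e u v).
(* One step size below both thresholds, so that both second differences are taken with the same
   [s]. *)
pose s := Num.min d d' / 2.
have m0 : 0 < Num.min d d' by rewrite lt_min d0 d'0.
have s0 : 0 < s by rewrite divr_gt0.
have sm : s < Num.min d d' by rewrite ltr_pdivrMr// ltr_pMr// ltr1n.
have [sd sd'] : s < d /\ s < d' by move: sm; rewrite lt_min => /andP[].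
have [w /= wz Ew] := Hd s (introT andP (conj s0 sd)).
have [w' /= wz' Ew'] := Hd' s (introT andP (conj s0 sd')).
move: wz wz' Ew Ew'.
move: ('D_v ('D_u f) w) ('D_u ('D_v f) w') ('D_v ('D_u f) z) ('D_u ('D_v f) z).
move=> x x' y y' xy xy' Ex Ex'.
have xx' : x' = x.
  have ss0 : s * s != 0 by rewrite mulf_neq0// gt_eqF.
  apply: (mulfI ss0); rewrite -Ex -Ex' [z + s *: v + _]addrAC.
  by congr (_ + _); rewrite -!addrA [- _ - _]addrC.
rewrite addr0 [e]splitr -(subrKA x') (le_trans (ler_normD _ _))//.
by rewrite lerD// ?(ltW xy')// xx' distrC ltW.
Qed.

End Schwarz.

(** * Vector fields on the jet bundle *)

Section DifferentiationRules.
Context (R : realType) (V W : normedModType R).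

Lemma differentiable_sum_fun m (F : 'I_m -> V -> W) z :
  (forall i, differentiable (F i) z) ->
  differentiable (fun x => \sum_(i < m) F i x) z.
Proof.
move=> dF; have -> : (fun x => \sum_(i < m) F i x) = \sum_(i < m) F i.
  by apply/funext => x; rewrite fct_sumE.
exact: differentiable_sum.
Qed.

Lemma derive_sum_fun m (F : 'I_m -> V -> W) z w :
  (forall i, differentiable (F i) z) ->
  'D_w (fun x => \sum_(i < m) F i x) z = \sum_(i < m) 'D_w (F i) z.
Proof.
move=> dF; have -> : (fun x => \sum_(i < m) F i x) = \sum_(i < m) F i.
  by apply/funext => x; rewrite fct_sumE.
by rewrite derive_sum// => i; exact: diff_derivable.
Qed.

Lemma derive_scalel (k : V -> R) (c : W) z w : differentiable k z ->
  'D_w (fun x => k x *: c) z = 'D_w k z *: c.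
Proof.
move=> dk; rewrite (deriveE _ dk) (deriveE _ (differentiableZl c dk)).
by rewrite diffZl.
Qed.

Lemma derive_mul (f g : V -> R) z w :
  differentiable f z -> differentiable g z ->
  'D_w (fun x => f x * g x) z = 'D_w f z * g z + f z * 'D_w g z.
Proof.
move=> df dg; rewrite deriveM; [|exact: diff_derivable|exact: diff_derivable].
by rewrite addrC; congr (_ + _); rewrite -[LHS]/(_ * _) mulrC.
Qed.

Lemma derive_invariant (f : V -> W) z w :
  (forall s : R, f (z + s *: w) = f z) -> 'D_w f z = 0.
Proof.
move=> fw; rewrite /derive.
have -> : (fun h : R => h^-1 *: ((f \o shift z) (h *: w) - f z)) = cst 0.
  by apply/funext => h /=; rewrite [_ + z]addrC fw subrr scaler0.
exact: lim_cst.
Qed.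

Lemma derive_translate_invariant (A : set V) (f : V -> W) z u w : open A ->
  (forall x, A x -> f (x + w) = f x) -> A z -> 'D_u f (z + w) = 'D_u f z.
Proof.
by move=> oA fw Az; rewrite -derive_translate; exact: (derive_ext oA).
Qed.

End DifferentiationRules.

Lemma is_diff_fst (R : realType) (U V : normedModType R) (z : U * V) :
  is_diff z (fst : U * V -> U) fst.
Proof.
have c : continuous (fst : U * V -> U) by move=> x; exact: cvg_fst.
by apply: DiffDef; [exact: (linear_differentiable z c)|exact: (diff_lin z c)].
Qed.

(** This map moves every point of a fibre to the fixed fibre vector [v]; its differential does not
    depend on the point, as [smooth_on_comp] requires. *)
Lemma is_diff_replace_snd (R : realType) (U V : normedModType R) (v : V)
    (z : U * V) :
  is_diff z (fun x : U * V => (x.1, v)) (fun w : U * V => (w.1, 0)).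
Proof. exact: (is_diff_pair (is_diff_fst z) (is_diff_cst v z)). Qed.

Section JetFields.
Context (R : realType) (p n : nat).
Local Notation E := (jet_coords R p n).

Definition horizontal (e : E) (m : 'I_n -> 'I_p -> E -> R) : E -> E :=
  fun z => e - \sum_(j < n) \sum_(b < p) m j b z *: ddv j b z.

Lemma sum_ddv (c : 'I_n -> 'I_p -> R) (z : E) :
  \sum_(j < n) \sum_(b < p) c j b *: ddv j b z
  = (0, 0, \matrix_(j, b) c j b).
Proof.
rewrite [in RHS](matrix_sum_delta (\matrix_(j, b) c j b)).
pose phi (v : 'M[R]_(n, p)) : E := (0, 0, v).
have phiD : {morph phi : v w / v + w >-> v + w}.
  by move=> v w; congr (_, _, _); rewrite addr0.
have phi0 : phi 0 = 0 by [].
rewrite -/(phi _) (big_morph phi phiD phi0); apply: eq_bigr => j _.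
rewrite (big_morph phi phiD phi0); apply: eq_bigr => b _.
by rewrite mxE; congr (_, _, _); rewrite scaler0.
Qed.

Lemma horizontalE e m z :
  horizontal e m z = (e.1, e.2 - \matrix_(j, b) m j b z).
Proof.
by rewrite /horizontal sum_ddv; case: e => -[a b] v; congr (_, _, _);
  rewrite subr0.
Qed.

(** Both [e] and the fields [ddv j b] are constant, so only the coefficients get differentiated. *)
Lemma derive_horizontal e m z w :
  (forall j b, differentiable (m j b) z) ->
  'D_w (horizontal e m) z
  = - \sum_(j < n) \sum_(b < p) 'D_w (m j b) z *: ddv j b z.
Proof.
move=> dm.
have dmv j b : differentiable (fun x => m j b x *: ddv j b z) z.
  exact: differentiableZl.
have dmj j : differentiable (fun x => \sum_b m j b x *: ddv j b z) z.
  exact: differentiable_sum_fun.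
rewrite deriveB; [|exact: derivable_cst|]; last first.
  by apply: diff_derivable; exact: differentiable_sum_fun.
rewrite derive_cst sub0r derive_sum_fun//; congr (- _).
apply: eq_bigr => j _; rewrite derive_sum_fun//; apply: eq_bigr => b _.
by rewrite derive_scalel.
Qed.

Lemma along_horizontal e m (f : E -> R) z : differentiable f z ->
  along (horizontal e m) f z
  = 'D_e f z - \sum_(j < n) \sum_(b < p) m j b z * along (ddv j b) f z.
Proof.
move=> df; rewrite /along !(deriveE _ df) /horizontal linearB; congr (_ - _).
rewrite linear_sum; apply: eq_bigr => j _; rewrite linear_sum.
by apply: eq_bigr => b _; rewrite linearZ (deriveE _ df).
Qed.

Lemma bracket_horizontal e e' m m' z :
  (forall j b, differentiable (m j b) z) ->
  (forall j b, differentiable (m' j b) z) ->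
  bracket (horizontal e m) (horizontal e' m') z
  = \sum_(j < n) \sum_(b < p) (along (horizontal e' m') (m j b) z
      - along (horizontal e m) (m' j b) z) *: ddv j b z.
Proof.
move=> dm dm'; rewrite /bracket /along !derive_horizontal// opprK addrC -sumrB.
apply: eq_bigr => j _; rewrite -sumrB; apply: eq_bigr => b _.
by rewrite scalerBl.
Qed.

Lemma bracket_ddv_horizontal j b e m z :
  (forall j b, differentiable (m j b) z) ->
  bracket (ddv j b) (horizontal e m) z
  = - \sum_(k < n) \sum_(c < p) along (ddv j b) (m k c) z *: ddv k c z.
Proof.
by move=> dm; rewrite /bracket /along derive_horizontal// derive_cst subr0.
Qed.

Lemma bracket_ddv j b k c (z : E) : bracket (ddv j b) (ddv k c) z = 0.
Proof. by rewrite /bracket /along !derive_cst subr0. Qed.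

Lemma is_diff_fibre (i : 'I_n) (a : 'I_p) (z : E) :
  is_diff z (fun w : E => w.2 i a) (fun w : E => w.2 i a).
Proof.
have @phi : {linear E -> R}.
  by exists (fun w : E => w.2 i a); do 2![eexists]; do ?[constructor];
     rewrite ?mxE// => ? *; rewrite ?mxE//; move=> ?; rewrite !mxE.
have cphi : continuous phi.
  move=> w; apply: (@continuous_comp _ _ _ snd (fun v : 'M[R]_(n, p) => v i a)).
    exact: cvg_snd.
  exact: coord_continuous.
apply: DiffDef; first exact: (linear_differentiable (f := phi)).
by rewrite (diff_lin (f := phi)).
Qed.

Lemma differentiable_fibre (i : 'I_n) (a : 'I_p) (z : E) :
  differentiable (fun w : E => w.2 i a) z.
Proof. exact: (@ex_diff _ _ _ _ _ _ _ (is_diff_fibre i a z)). Qed.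

Lemma derive_fibre (i : 'I_n) (a : 'I_p) (z w : E) :
  'D_w (fun w : E => w.2 i a) z = w.2 i a.
Proof.
by rewrite deriveE ?(@diff_val _ _ _ _ _ _ _ (is_diff_fibre i a z))//;
  exact: differentiable_fibre.
Qed.

End JetFields.

Lemma sum_ord1 (V : nmodType) (p : nat) (a : 'I_p) (F : 'I_p -> V) : p = 1%N ->
  \sum_(b < p) F b = F a.
Proof. by move=> p1; subst p; rewrite big_ord1 (ord1 a). Qed.

Lemma smooth_on_along (R : realType) (p n : nat) (A : set (jet_coords R p n))
    (v : jet_coords R p n) (f : jet_coords R p n -> R) :
  smooth_on A f -> smooth_on A (fun z => along (fun _ => v) f z).
Proof. by move=> sf; exact: smooth_on_derive sf. Qed.

(** * Christoffel symbols: smoothness, symmetry, translation invariance *)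

Section Christoffel.
Context (R : realType) (p n m : nat).
Local Notation E := (jet_coords R p n).
Context (A : set E) (G : E -> 'M[R]_m).
Hypotheses (oA : open A) (sG : smooth_on A G).

Lemma smooth_on_christoffel (e : 'I_m -> E) i j k :
  (forall z, A z -> G z \in unitmx) ->
  smooth_on A (christoffel (fun l _ => e l) G i j k).
Proof.
move=> uG.
have sGe i' j' : smooth_on A (fun z => G z i' j') by exact: smooth_on_entry.
apply: (smooth_on_sum oA) => l _; apply: (smooth_onM oA).
  apply: (smooth_onM oA); first exact: smooth_on_invmx.
  exact: (smooth_on_cst oA (_ : R)).
by apply: (smooth_onB oA); [apply: (smooth_onD oA)|];
  apply: smooth_on_along.
Qed.

(** The exchange of [j] and [k] permutes the first two terms and transposes [G] in the third.
    Arbitrary fields [X] are allowed, so that one lemma serves [Chr_t], [Chr_x], [Lcf] and [Ccf]. *)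
Lemma christoffel_sym (X : 'I_m -> E -> E) i j k z :
  (forall z, A z -> (G z)^T = G z) -> A z ->
  christoffel X G i j k z = christoffel X G i k j z.
Proof.
move=> GT Az; apply: eq_bigr => l _; congr (_ * _).
congr (_ - _); first by rewrite addrC.
by apply: (derive_ext oA) => // x Ax; rewrite -[in LHS]GT// mxE.
Qed.

(** Applied to [h] it shows that H depends on t alone, applied to [g] that Gamma is constant on the
    fibres when [g] is. *)
Lemma christoffel_translate (e : 'I_m -> E) i j k z w :
  (forall x, A x -> G (x + w) = G x) -> A z ->
  christoffel (fun l _ => e l) G i j k (z + w)
  = christoffel (fun l _ => e l) G i j k z.
Proof.
move=> Gw Az; rewrite /christoffel /along (Gw z Az); apply: eq_bigr => l _.
have D i' j' l' : 'D_(e l') (fun x => G x i' j') (z + w)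
    = 'D_(e l') (fun x => G x i' j') z.
  by apply: (derive_translate_invariant _ oA) => // x Ax; rewrite Gw.
by rewrite !D.
Qed.

End Christoffel.

(** * Local expressions of a Lagrange space in one jet chart *)

Section LocalLagrange.
Context (R : realType) (p n : nat).
Local Notation E := (jet_coords R p n).
Context (A : set E) (h : E -> 'M[R]_p) (L : E -> R) (g : E -> 'M[R]_n).
Hypotheses (oA : open A) (fA : forall (z : E) u, A z -> A (z.1, u)).
Hypotheses (sh : smooth_on A h) (sL : smooth_on A L) (sg : smooth_on A g).
Hypotheses (hT : forall z, A z -> (h z)^T = h z).
Hypotheses (gT : forall z, A z -> (g z)^T = g z).
Hypotheses (uh : forall z, A z -> h z \in unitmx).
Hypotheses (ug : forall z, A z -> g z \in unitmx).
(** Dependence of [h] on t alone, in the form that is inherited by derivatives. *)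
Hypothesis h_base : forall z w : E, w.1.1 = 0 -> h (z + w) = h z.

Let smooth_h a b : smooth_on A (fun z => h z a b).
Proof. exact: smooth_on_entry. Qed.

Let smooth_g i j : smooth_on A (fun z => g z i j).
Proof. exact: smooth_on_entry. Qed.

Let smooth_invh a b : smooth_on A (fun z => invmx (h z) a b).
Proof. exact: smooth_on_invmx. Qed.

Let smooth_invg i j : smooth_on A (fun z => invmx (g z) i j).
Proof. exact: smooth_on_invmx. Qed.

Let smooth_const (x : R) : smooth_on A (fun _ => x).
Proof. exact: (smooth_on_cst oA x). Qed.

Lemma smooth_on_fibre i a : smooth_on A (fun z => z.2 i a).
Proof.
case=> // k; split=> [z _|v]; first exact: differentiable_fibre.
apply: (differentiable_upto_ext oA) (smooth_const (v.2 i a) k) => z _.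
by rewrite derive_fibre.
Qed.

Lemma smooth_on_Chr_t c a b : smooth_on A (Chr_t h c a b).
Proof. exact: smooth_on_christoffel. Qed.

Lemma smooth_on_Chr_x l j k : smooth_on A (Chr_x g l j k).
Proof. exact: smooth_on_christoffel. Qed.

Lemma smooth_on_Mcan i a b : smooth_on A (Mcan h i a b).
Proof.
apply: (smooth_onN oA); apply: (smooth_on_sum oA) => c _.
by apply: (smooth_onM oA); [exact: smooth_on_Chr_t|exact: smooth_on_fibre].
Qed.

Lemma smooth_on_spray a i : smooth_on A (spray h L g a i).
Proof.
apply: (smooth_on_sum oA) => k _; apply: (smooth_onM oA).
  by apply: (smooth_onM oA).
apply: (smooth_onD oA); last first.
  apply: (smooth_onM oA); last first.
    apply: (smooth_on_sum oA) => l _.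
    by apply: (smooth_onM oA) => //; exact: smooth_on_fibre.
  apply: (smooth_onM oA); last exact: smooth_on_Chr_t.
  exact: (smooth_onM oA).
apply: (smooth_onD oA); last first.
  apply: (smooth_onM oA); last exact: smooth_on_Chr_t.
  exact: smooth_on_along.
apply: (smooth_onD oA); last by do 2! apply: smooth_on_along.
apply: (smooth_onB oA); last exact: smooth_on_along.
apply: (smooth_on_sum oA) => j _; apply: (smooth_onM oA).
  by do 2! apply: smooth_on_along.
exact: smooth_on_fibre.
Qed.

Lemma along_Chr_t_eq0 c a b (X : E -> E) z : A z -> (X z).1.1 = 0 ->
  along X (Chr_t h c a b) z = 0.
Proof.
move=> Az w0; apply: derive_invariant => s.
by apply: (christoffel_translate oA) => // x _; rewrite h_base//= w0 scaler0.
Qed.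

(** M is a sum of products of a Christoffel symbol and a fibre coordinate, and the derivative of a
    fibre coordinate along [X] is the matching vertical component of [X z]. *)
Lemma along_Mcan i a b (X : E -> E) z : A z ->
  along X (Mcan h i a b) z = - \sum_(c < p)
    (along X (Chr_t h c a b) z * z.2 i c + Chr_t h c a b z * (X z).2 i c).
Proof.
move=> Az; rewrite /along.
have dC c : differentiable (Chr_t h c a b) z.
  exact: smooth_on_differentiable (smooth_on_Chr_t _ _ _) Az.
have dF c := differentiable_fibre i c z.
have dCF c : differentiable (fun x : E => Chr_t h c a b x * x.2 i c) z.
  exact: differentiableM.
rewrite deriveN; last by apply: diff_derivable; exact: differentiable_sum_fun.
rewrite derive_sum_fun//; congr (- _); apply: eq_bigr => c _.
by rewrite derive_mul// derive_fibre.
Qed.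

Lemma delt_horizontal a :
  delt h a = horizontal (delta_mx 0 a, 0, 0) (fun j b => Mcan h j b a).
Proof. by []. Qed.

Lemma delx_horizontal i :
  delx A h L g i
  = horizontal (0, delta_mx 0 i, 0) (fun j b => Ncan A h L g j b i).
Proof. by []. Qed.

Lemma delt_fibre a z j b : (delt h a z).2 j b = - Mcan h j b a z.
Proof. by rewrite delt_horizontal horizontalE !mxE sub0r. Qed.

Lemma delx_fibre i z j b : (delx A h L g i z).2 j b = - Ncan A h L g j b i z.
Proof. by rewrite delx_horizontal horizontalE !mxE sub0r. Qed.

Lemma along_delt a (f : E -> R) z : differentiable f z ->
  along (delt h a) f z = along (ddt a) f z
    - \sum_(j < n) \sum_(b < p) Mcan h j b a z * along (ddv j b) f z.
Proof. by move=> df; rewrite delt_horizontal along_horizontal. Qed.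

Lemma along_delx i (f : E -> R) z : differentiable f z ->
  along (delx A h L g i) f z = along (ddx i) f z
    - \sum_(j < n) \sum_(b < p) Ncan A h L g j b i z * along (ddv j b) f z.
Proof. by move=> df; rewrite delx_horizontal along_horizontal. Qed.

Lemma along_delt_Chr_t a c b e z : A z ->
  along (delt h a) (Chr_t h c b e) z = along (ddt a) (Chr_t h c b e) z.
Proof.
move=> Az; rewrite along_delt; last first.
  exact: smooth_on_differentiable (smooth_on_Chr_t _ _ _) Az.
rewrite big1 ?subr0// => j _; rewrite big1// => b' _.
by rewrite along_Chr_t_eq0// mulr0.
Qed.

(** The vertical component of delta/delta t is - M = H x, so differentiating the factor x in M = - H
    x reproduces H x; these are the quadratic terms [S] of the curvature of [h]. *)
Lemma along_delt_Mcan m mu a b z : A z ->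
  along (delt h b) (Mcan h m mu a) z - along (delt h a) (Mcan h m mu b) z
  = - \sum_(e < p) Curv_t h e mu a b z * z.2 m e.
Proof.
move=> Az; pose S a b e := \sum_(k < p) Chr_t h k mu a z * Chr_t h e k b z.
have SE a' b' : \sum_(c < p) Chr_t h c mu a' z * (delt h b' z).2 m c
    = \sum_(e < p) S a' b' e * z.2 m e.
  under [RHS]eq_bigr do rewrite mulr_suml.
  rewrite exchange_big; apply: eq_bigr => c _.
  rewrite delt_fibre opprK mulr_sumr.
  by apply: eq_bigr => e _; rewrite mulrA.
have DM a' b' : along (delt h b') (Mcan h m mu a') z
    = - \sum_(e < p) (along (ddt b') (Chr_t h e mu a') z + S a' b' e) * z.2 m e.
  rewrite (along_Mcan _ _ _ _ Az) big_split SE -big_split; congr (- _).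
  by apply: eq_bigr => e _ /=; rewrite along_delt_Chr_t// mulrDl.
apply: (eq_trans (congr2 (fun x y => x - y) (DM a b) (DM b a))).
rewrite -opprD -sumrB; congr (- _); apply: eq_bigr => e _.
have -> : Curv_t h e mu a b z = along (ddt b) (Chr_t h e mu a) z
  - along (ddt a) (Chr_t h e mu b) z + S a b e - S b a e by [].
rewrite -mulrBl; congr (_ * _).
by rewrite opprD addrACA !addrA.
Qed.

Lemma along_delx_Mcan m mu a j z : A z ->
  along (delx A h L g j) (Mcan h m mu a) z
  = \sum_(c < p) Chr_t h c mu a z * Ncan A h L g m c j z.
Proof.
move=> Az; rewrite (along_Mcan _ _ _ _ Az) -sumrN; apply: eq_bigr => c _.
rewrite along_Chr_t_eq0//; last by rewrite delx_horizontal horizontalE.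
by rewrite mul0r add0r delx_fibre mulrN opprK.
Qed.

Lemma along_ddv_Mcan m mu a j b z : A z ->
  along (ddv j b) (Mcan h m mu a) z = - ((m == j)%:R * Chr_t h b mu a z).
Proof.
move=> Az; rewrite (along_Mcan _ _ _ _ Az) (bigD1 b)//= big1 => [|c cb].
  by rewrite along_Chr_t_eq0// mul0r add0r addr0 mxE eqxx andbT mulrC.
by rewrite along_Chr_t_eq0// mul0r add0r mxE (negbTE cb) andbF mulr0.
Qed.

Hypothesis KR : Kronecker_regular A h L g.

(** Invariance under vertical translations, preferred to vanishing vertical derivatives because it
    passes to derivatives in every constant direction. *)
Definition fibre_constant (W : normedModType R) (f : E -> W) :=
  forall z w, A z -> w.1 = 0 -> f (z + w) = f z.

Lemma fibre_constant_along_eq0 (W : normedModType R) (f : E -> W)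
    (X : E -> E) z :
  fibre_constant f -> A z -> (X z).1 = 0 -> along X f z = 0.
Proof.
move=> ff Az X0; apply: derive_invariant => s.
by apply: ff => //=; rewrite X0 scaler0.
Qed.

Lemma fibre_constant_derive (W : normedModType R) (f : E -> W) (v : E) :
  fibre_constant f -> fibre_constant (fun z => along (fun _ => v) f z).
Proof.
move=> ff z w Az w0; apply: (derive_translate_invariant _ oA) => // x Ax.
exact: ff.
Qed.

Lemma fibre_constant_entry m1 m2 (F : E -> 'M[R]_(m1, m2)) i j :
  fibre_constant F -> fibre_constant (fun z => F z i j).
Proof. by move=> fF z w Az w0; rewrite fF. Qed.

Lemma fibre_constant_h : fibre_constant h.
Proof. by move=> z w _ w0; rewrite h_base// w0. Qed.

Lemma along_delx_fibre_constant i (f : E -> R) z :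
  fibre_constant f -> differentiable f z -> A z ->
  along (delx A h L g i) f z = along (ddx i) f z.
Proof.
move=> ff df Az; rewrite along_delx// big1 ?subr0// => j _.
by rewrite big1// => b _; rewrite fibre_constant_along_eq0// mulr0.
Qed.

(** * The case p >= 2: metric, U, N and the bracket coefficients *)

Section SeveralTimes.
Hypothesis p_gt1 : (1 < p)%N.

(* The third vertical derivatives of [L] are totally symmetric, so
   [h^{ab} d_(k,c) g_ij] is unchanged when [(k, c)] and [(i, a)] are exchanged;
   contracting with [h_{ba}] for some [a != c] kills the right-hand side. *)
Lemma along_ddv_metric k c i j z : A z ->
  along (ddv k c) (fun x => g x i j) z = 0.
Proof.
(* Here two times are needed: one of the indices 0 and 1 differs from [c]. *)
move=> Az; have [a ac] : exists a : 'I_p, a != c.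
  have [c0|c0] := eqVneq c (Ordinal (ltnW p_gt1)).
    by exists (Ordinal p_gt1); rewrite c0.
  by exists (Ordinal (ltnW p_gt1)); rewrite eq_sym.
have third i' j' k' a' b' c' :
    invmx (h z) a' b' * along (ddv k' c') (fun x => g x i' j') z
    = 2^-1 * along (ddv k' c') (along (ddv i' a') (along (ddv j' b') L)) z.
  have dS : differentiable (along (ddv i' a') (along (ddv j' b') L)) z.
    by apply: (smooth_on_differentiable _ Az); do 2! apply: smooth_on_along.
  have dih := smooth_on_differentiable (smooth_invh a' b') Az.
  have dg := smooth_on_differentiable (smooth_g i' j') Az.
  transitivity (along (ddv k' c') (fun x => invmx (h x) a' b' * g x i' j') z).
    apply: esym; apply: (eq_trans (derive_mul _ dih dg)).
    rewrite (_ : 'D_(ddv k' c' z) (fun x => invmx (h x) a' b') z = 0).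
      by rewrite mul0r add0r.
    by apply: derive_invariant => s; rewrite h_base//= scaler0.
  transitivity (along (ddv k' c') (fun x => 2^-1 *
      along (ddv i' a') (along (ddv j' b') L) x) z).
    by apply: (derive_ext oA) => // x Ax; rewrite KR.
  apply: (eq_trans (derive_mul _ (differentiable_cst (2^-1 : R) z) dS)).
  by rewrite derive_cst mul0r add0r.
have exch b : invmx (h z) a b * along (ddv k c) (fun x => g x i j) z
    = invmx (h z) c b * along (ddv i a) (fun x => g x k j) z.
  apply: (eq_trans (third i j k a b c)).
  apply: (eq_trans _ (esym (third k j i c b a))).
  have := schwarz oA (smooth_on_along (0, 0, delta_mx j b) sL)
    (0, 0, delta_mx k c) (0, 0, delta_mx i a) Az.
  exact: (congr1 (fun x => 2^-1 * x)).
have mulVh e : \sum_b invmx (h z) e b * h z b a = (e == a)%:R.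
  by have /matrixP/(_ e a) := mulVmx (uh Az); rewrite !mxE.
transitivity (\sum_b (invmx (h z) a b * h z b a)
    * along (ddv k c) (fun x => g x i j) z).
  by rewrite -mulr_suml mulVh eqxx mul1r.
under eq_bigr do rewrite mulrAC exch mulrAC.
by rewrite -mulr_suml mulVh eq_sym (negbTE ac) mul0r.
Qed.

(** The segment from [z] to [z + w] stays in the fibre, hence in [A], and the derivative of each
    entry vanishes along it; the mean value theorem concludes. *)
Lemma fibre_constant_metric : fibre_constant g.
Proof.
move=> z w Az w0; apply/matrixP => i j.
have At t : A (z + t *: w).
  have -> : z + t *: w = (z.1, z.2 + t *: w.2).
    by rewrite [LHS]surjective_pairing /= w0 scaler0 addr0.
  exact: fA.
have dg t : differentiable (fun x => g x i j) (z + t *: w).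
  exact: smooth_on_differentiable (smooth_g i j) (At t).
(* Writing the vertical vector [w] as a field of the form [horizontal] lets [along_horizontal]
   expand its derivative into those along [ddv k c]. The sign undoes the minus in [horizontal]. *)
have wE x : w = horizontal 0 (fun k c _ => - w.2 k c) x.
  rewrite horizontalE [LHS]surjective_pairing w0; congr (_, _).
  by rewrite sub0r; apply/matrixP => k c; rewrite !mxE opprK.
have Dg t : 'D_w (fun x => g x i j) (z + t *: w) = 0.
  have -> : 'D_w (fun x => g x i j) (z + t *: w) = along
      (horizontal 0 (fun k c _ => - w.2 k c)) (fun x => g x i j) (z + t *: w).
    by rewrite /along -wE.
  rewrite along_horizontal// derive0 sub0r.
  rewrite big1 ?oppr0// => k _; rewrite big1// => c _.
  by rewrite along_ddv_metric// mulr0.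
have [|t _] := @MVT_line _ _ (fun x => g x i j) z w 1 ltr01.
  by move=> t _; exact: diff_derivable.
by rewrite Dg mulr0 scale1r => /subr0_eq.
Qed.

Lemma fibre_translate (z : E) v : (z.1, v) = z + (0, v - z.2).
Proof. by rewrite [RHS]surjective_pairing /= addr0 subrKC. Qed.

(* [U] is half the odd part of [L] on each fibre: the quadratic part cancels in
   [L (t, x, v) - L (t, x, - v)]. *)
Lemma smooth_on_Utensor i a :
  smooth_on A (fun z => Utensor A h L g z.1 i a).
Proof.
(* If [L] had no affine decomposition, [Utensor] would be its default value 0, which is smooth as
   well. *)
rewrite /Utensor; case: xgetP => [U _ [F UF]|_]; last first.
  by apply: smooth_on_ext (smooth_const 0) => // z _; rewrite mxE.
(* Over each base point the fibre vector is s times the (i, a) unit vector, which isolates one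
   component of U: the values of [L] at s = 1 and s = -1 differ by twice that component. *)
pose e (s : R) (z : E) : E := (z.1, s *: delta_mx i a).
have sLe s : smooth_on A (fun z => L (e s z)).
  apply: (smooth_on_comp (is_diff_replace_snd (s *: delta_mx i a))) => //.
  by move=> z Az; exact: fA.
have Le s z : A z -> L (e s z) = \sum_(k < n) \sum_(j < n) \sum_(b < p)
      \sum_(c < p) invmx (h z) b c * g z k j * (s *: delta_mx i a) k b
      * (s *: delta_mx i a) j c + s * U z.1 i a + F z.1.
  move=> Az; rewrite UF; last exact: fA.
  rewrite /e fibre_translate h_base//= fibre_constant_metric//=.
  rewrite addr0 subrKC; congr (_ + _ + _).
  rewrite (bigD1 i)//= [X in _ + X]big1 => [|k ki]; last first.
    by rewrite big1// => b _; rewrite !mxE (negbTE ki) mulr0 mulr0.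
  rewrite (bigD1 a)//= [X in _ + X + _]big1 => [|b ba]; last first.
    by rewrite !mxE (negbTE ba) andbF mulr0 mulr0.
  by rewrite !addr0 !mxE !eqxx mulr1 mulrC.
have sU := smooth_onM oA (smooth_onB oA (sLe 1) (sLe (-1))) (smooth_const 2^-1).
apply: (smooth_on_ext oA) sU => z Az; rewrite !Le// scaleN1r scale1r.
have -> : \sum_(k < n) \sum_(j < n) \sum_(b < p) \sum_(c < p)
    invmx (h z) b c * g z k j * (- delta_mx i a : 'M[R]_(n, p)) k b
      * (- delta_mx i a : 'M[R]_(n, p)) j c
  = \sum_(k < n) \sum_(j < n) \sum_(b < p) \sum_(c < p)
    invmx (h z) b c * g z k j * (delta_mx i a : 'M[R]_(n, p)) k b
      * (delta_mx i a : 'M[R]_(n, p)) j c.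
  apply: eq_bigr => k _; apply: eq_bigr => j _; apply: eq_bigr => b _.
  apply: eq_bigr => c _.
  by rewrite [X in _ * X * _]mxE [X in _ * X = _]mxE mulrN mulrN mulNr opprK.
by field.
Qed.

Lemma smooth_on_Ucurl a i j : smooth_on A (Ucurl A h L g a i j).
Proof.
by apply: (smooth_onB oA); apply: smooth_on_along; exact: smooth_on_Utensor.
Qed.

Lemma fibre_constant_Ucurl a i j : fibre_constant (Ucurl A h L g a i j).
Proof.
have fU i' a' : fibre_constant (fun z => Utensor A h L g z.1 i' a').
  by move=> z w _ w0 /=; rewrite w0 addr0.
move=> z w Az w0; rewrite /Ucurl.
by congr (_ - _); apply: (fibre_constant_derive _ (fU _ _)).
Qed.

Lemma smooth_on_Ften m i a : smooth_on A (Ften A h L g m i a).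
Proof.
apply: (smooth_on_sum oA) => q _; apply: (smooth_onM oA).
  exact: (smooth_onM oA).
apply: (smooth_onD oA); first exact: smooth_on_along.
apply: (smooth_onM oA) => //; apply: (smooth_on_sum oA) => b _.
by apply: (smooth_onM oA) => //; exact: smooth_on_Ucurl.
Qed.

Lemma fibre_constant_Ften m i a : fibre_constant (Ften A h L g m i a).
Proof.
move=> z w Az w0; rewrite /Ften fibre_constant_metric//; apply: eq_bigr => q _.
congr (_ * (_ + _ * _)).
  apply: fibre_constant_derive => //.
  exact/fibre_constant_entry/fibre_constant_metric.
by apply: eq_bigr => b _; rewrite fibre_constant_h// fibre_constant_Ucurl.
Qed.

Lemma fibre_constant_Chr_x l j k : fibre_constant (Chr_x g l j k).
Proof.
move=> z w Az w0; apply: (christoffel_translate oA) => // x Ax.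
exact: fibre_constant_metric.
Qed.

Lemma NcanE i a j z : A z -> Ncan A h L g i a j z
  = \sum_(k < n) Chr_x g i j k z * z.2 k a + Ften A h L g i j a z.
Proof.
move=> Az; rewrite /Ncan gtn_eqF// -addrA; congr (_ + _).
rewrite -big_split; apply: eq_bigr => k _ /=.
rewrite mulrDr; congr (_ + _).
  congr (_ * _); apply: (derive_ext oA) => // x Ax.
  by rewrite -[in LHS]gT// mxE.
rewrite !mulr_sumr; apply: eq_bigr => c _.
by move: (invmx _ _ _) (h _ _ _) (Ucurl _ _ _ _ _ _ _ _) => x y u; field.
Qed.

Lemma smooth_on_Ncan_gt1 i a j : smooth_on A (Ncan A h L g i a j).
Proof.
apply: smooth_on_ext => [//|z Az|]; first by rewrite NcanE.
apply: (smooth_onD oA); last exact: smooth_on_Ften.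
apply: (smooth_on_sum oA) => k _.
by apply: (smooth_onM oA); [exact: smooth_on_Chr_x|exact: smooth_on_fibre].
Qed.

Lemma along_Ncan i a j (X : E -> E) z : A z ->
  along X (Ncan A h L g i a j) z
  = \sum_(k < n) (along X (Chr_x g i j k) z * z.2 k a
                  + Chr_x g i j k z * (X z).2 k a)
    + along X (Ften A h L g i j a) z.
Proof.
move=> Az.
have dC k : differentiable (Chr_x g i j k) z.
  exact: smooth_on_differentiable (smooth_on_Chr_x _ _ _) Az.
have dF k := differentiable_fibre k a z.
have dCF k : differentiable (fun x : E => Chr_x g i j k x * x.2 k a) z.
  exact: differentiableM.
have dFt : differentiable (Ften A h L g i j a) z.
  exact: smooth_on_differentiable (smooth_on_Ften _ _ _) Az.
rewrite /along.
transitivity ('D_(X z) (fun x : E => \sum_(k < n) Chr_x g i j k x * x.2 k a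
    + Ften A h L g i j a x) z).
  by apply: (derive_ext oA) Az => x Ax; exact: NcanE.
rewrite deriveD; [|by apply: diff_derivable; exact: differentiable_sum_fun
  |exact: diff_derivable].
rewrite derive_sum_fun//; congr (_ + _); apply: eq_bigr => k _.
by rewrite derive_mul// derive_fibre.
Qed.

Lemma along_ddv_Ncan k c m mu i z : A z ->
  along (ddv k c) (Ncan A h L g m mu i) z = (mu == c)%:R * Chr_x g m i k z.
Proof.
move=> Az; apply: (eq_trans (along_Ncan m mu i (ddv k c) Az)).
have F0 : along (ddv k c) (Ften A h L g m i mu) z = 0.
  exact: fibre_constant_along_eq0 (@fibre_constant_Ften _ _ _) Az _.
have C0 l : along (ddv k c) (Chr_x g m i l) z = 0.
  exact: fibre_constant_along_eq0 (@fibre_constant_Chr_x _ _ _) Az _.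
rewrite F0 addr0 (bigD1 k)//= big1 => [|l lk].
  by rewrite C0 mul0r add0r addr0 mxE eqxx mulrC.
by rewrite C0 mul0r add0r mxE (negbTE lk) mulr0.
Qed.

Lemma Lcf_Chr_x i j k z : A z -> Lcf A h L g i j k z = Chr_x g i j k z.
Proof.
move=> Az.
have D a b l : along (delx A h L g l) (fun w => g w a b) z
    = along (ddx l) (fun w => g w a b) z.
  apply: along_delx_fibre_constant => //.
    exact/fibre_constant_entry/fibre_constant_metric.
  exact: smooth_on_differentiable (smooth_g _ _) Az.
have comb (x a b c a' b' c' : R) : a = a' -> b = b' -> c = c' ->
    x * (a + b - c) = x * (a' + b' - c') by move=> -> -> ->.
apply: eq_bigr => l _; exact: comb (D j l k) (D k l j) (D j k l).
Qed.

Lemma Ccf_eq0 i j c k z : A z -> Ccf g i j c k z = 0.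
Proof.
move=> Az; rewrite /Ccf /christoffel big1// => l _.
by rewrite !along_ddv_metric// addr0 subr0 mulr0.
Qed.

(** The derivative of M along delta/delta x is H N = H (Gamma x + F), while the vertical part of
    delta/delta t applied to N contributes - H Gamma x. The terms in Gamma cancel and H F is left,
    which the statement spells out. *)
Lemma mixed_coef_gt1 m mu a j z : A z ->
  along (delx A h L g j) (Mcan h m mu a) z
    - along (delt h a) (Ncan A h L g m mu j) z
  = - along (ddt a) (Ncan A h L g m mu j) z
    + \sum_(k < n) \sum_(b < p) invmx (g z) m k / 2 * Chr_t h b mu a z *
        (along (ddt b) (fun w => g w j k) z
         + \sum_(e < p) h z b e / 2 * Ucurl A h L g e k j z).
Proof.
move=> Az.
have dN := smooth_on_differentiable (smooth_on_Ncan_gt1 m mu j) Az.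
apply: (eq_trans (congr2 (fun x y => x - y)
  (along_delx_Mcan m mu a j Az) (along_delt a dN))).
have vert : \sum_(k < n) \sum_(b < p) Mcan h k b a z
      * along (ddv k b) (Ncan A h L g m mu j) z
    = - \sum_(c < p) Chr_t h c mu a z * \sum_(k < n) Chr_x g m j k z * z.2 k c.
  have row k : \sum_(b < p) Mcan h k b a z
        * along (ddv k b) (Ncan A h L g m mu j) z
      = - \sum_(c < p) Chr_t h c mu a z * (Chr_x g m j k z * z.2 k c).
    rewrite (bigD1 mu)//= big1 => [|b bmu]; last first.
      by rewrite along_ddv_Ncan// eq_sym (negbTE bmu) mul0r mulr0.
    rewrite along_ddv_Ncan// eqxx mul1r addr0 mulNr mulr_suml; congr (- _).
    by apply: eq_bigr => c _; rewrite mulrAC mulrA.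
  under eq_bigr do rewrite row.
  rewrite sumrN exchange_big; congr (- _); apply: eq_bigr => c _.
  by rewrite mulr_sumr.
have NE : \sum_(c < p) Chr_t h c mu a z * Ncan A h L g m c j z
    = \sum_(c < p) Chr_t h c mu a z * (\sum_(k < n) Chr_x g m j k z * z.2 k c)
      + \sum_(c < p) Chr_t h c mu a z * Ften A h L g m j c z.
  by rewrite -big_split; apply: eq_bigr => c _; rewrite NcanE// mulrDr.
have FE : \sum_(c < p) Chr_t h c mu a z * Ften A h L g m j c z
    = \sum_(k < n) \sum_(b < p) invmx (g z) m k / 2 * Chr_t h b mu a z *
        (along (ddt b) (fun w => g w j k) z
         + \sum_(e < p) h z b e / 2 * Ucurl A h L g e k j z).
  rewrite exchange_big; apply: eq_bigr => c _; rewrite mulr_sumr.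
  apply: eq_bigr => q _; rewrite mulrA [_ * (_ / 2)]mulrC.
  have -> : along (ddt c) (fun w => g w q j) z
      = along (ddt c) (fun w => g w j q) z.
    by apply: (derive_ext oA) => // x Ax; rewrite -[in LHS]gT// mxE.
  congr (_ * (_ + _)); rewrite mulr_sumr; apply: eq_bigr => e _.
  by rewrite mulrA [2^-1 * _]mulrC.
rewrite NE vert FE.
move: (along _ _ _) (\sum_c _) (\sum_k _) => x y u.
by ring.
Qed.

(** Differentiating x in Gamma x along delta/delta x gives - Gamma N, that is, - Gamma Gamma x -
    Gamma F ([Q] and [W]). After antisymmetrization in i, j the former completes the curvature of
    Gamma, and the latter supplies one Christoffel term of the covariant derivative of F. The other
    one, [V], is symmetric in i, j and drops out. *)
Lemma horizontal_coef_gt1 m mu i j z : A z ->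
  along (delx A h L g j) (Ncan A h L g m mu i) z
    - along (delx A h L g i) (Ncan A h L g m mu j) z
  = \sum_(k < n) Curv_x g m k i j z * z.2 k mu
    + (Fcov A h L g m i mu j z - Fcov A h L g m j mu i z).
Proof.
move=> Az.
pose P i j := \sum_(k < n) along (ddx j) (Chr_x g m k i) z * z.2 k mu.
pose Q i j := \sum_(k < n) \sum_(l < n)
  Chr_x g m i k z * Chr_x g k j l z * z.2 l mu.
pose W i j := \sum_(k < n) Chr_x g m i k z * Ften A h L g k j mu z.
pose D i j := along (delx A h L g j) (Ften A h L g m i mu) z.
pose V i j := \sum_(k < n) Ften A h L g m k mu z * Chr_x g k i j z.
have Gsym l a b : Chr_x g l a b z = Chr_x g l b a z.
  exact: (christoffel_sym oA).
have NE i' j' : along (delx A h L g j') (Ncan A h L g m mu i') z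
    = P i' j' - Q i' j' - W i' j' + D i' j'.
  apply: (eq_trans (along_Ncan m mu i' _ Az)).
  apply: (congr1 (fun x => x + D i' j')).
  rewrite -!sumrB; apply: eq_bigr => k _; rewrite delx_fibre NcanE//.
  have -> : along (delx A h L g j') (Chr_x g m i' k) z
      = along (ddx j') (Chr_x g m k i') z.
    apply: (eq_trans (along_delx_fibre_constant _
      (@fibre_constant_Chr_x _ _ _) _ Az)).
      exact: smooth_on_differentiable (smooth_on_Chr_x _ _ _) Az.
    by apply: (derive_ext oA) => // x Ax; exact: (christoffel_sym oA).
  rewrite mulrN mulrDr mulr_sumr opprD addrA; congr (_ - _ - _).
  by apply: eq_bigr => l _; rewrite mulrA.
have CE : \sum_(k < n) Curv_x g m k i j z * z.2 k mu
    = P i j - P j i + Q j i - Q i j.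
  have QE i' j' : Q i' j' = \sum_(k < n)
      (\sum_(l < n) Chr_x g l k j' z * Chr_x g m l i' z) * z.2 k mu.
    rewrite /Q exchange_big; apply: eq_bigr => l _; rewrite mulr_suml.
    by apply: eq_bigr => k _; rewrite [Chr_x g m i' k z]Gsym
      [Chr_x g k j' l z]Gsym [_ * Chr_x g m k i' z]mulrC.
  rewrite !QE -!sumrB -big_split -sumrB; apply: eq_bigr => k _ /=.
  by rewrite -!mulrBl -mulrDl -mulrBl.
have FE i' j' : Fcov A h L g m i' mu j' z = D i' j' + W j' i' - V i' j'.
  have WE : \sum_(k < n) Ften A h L g k i' mu z * Lcf A h L g m k j' z
      = W j' i'.
    by apply: eq_bigr => k _; rewrite Lcf_Chr_x// Gsym mulrC.
  have VE : \sum_(k < n) Ften A h L g m k mu z * Lcf A h L g k i' j' z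
      = V i' j'.
    by apply: eq_bigr => k _; rewrite Lcf_Chr_x.
  exact: (congr2 (fun x y => D i' j' + x - y) WE VE).
apply: (eq_trans (congr2 (fun x y => x - y) (NE i j) (NE j i))).
rewrite CE !FE.
have -> : V j i = V i j by apply: eq_bigr => k _; rewrite Gsym.
move: (P i j) (P j i) (Q i j) (Q j i) (W i j) (W j i) (D i j) (D j i) (V i j).
by move=> *; ring.
Qed.

End SeveralTimes.

Lemma smooth_on_Ncan i a j : smooth_on A (Ncan A h L g i a j).
Proof.
have [p1|p1] := boolP (p == 1%N); last first.
  (* The value p = 0 is excluded by the index [a : 'I_p]. *)
  by apply: smooth_on_Ncan_gt1; case: p a p1 => [|[|]] [].
apply: smooth_on_ext => [//|z _|]; first by rewrite /Ncan p1.
by apply: (smooth_onM oA) => //; apply: smooth_on_along; exact: smooth_on_spray.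
Qed.

(** With M = - H y, the vertical part of delta/delta t is H times the Liouville field y d/dy; this
    is the source of the last sum. *)
Lemma mixed_coef_1 m a j z : p = 1%N -> A z ->
  along (delx A h L g j) (Mcan h m a a) z
    - along (delt h a) (Ncan A h L g m a j) z
  = - along (ddt a) (Ncan A h L g m a j) z
    + Chr_t h a a a z * (Ncan A h L g m a j z
        - \sum_(k < n) along (ddv k a) (Ncan A h L g m a j) z * z.2 k a).
Proof.
move=> p1 Az.
have dN := smooth_on_differentiable (smooth_on_Ncan m a j) Az.
apply: (eq_trans (congr2 (fun x y => x - y)
  (along_delx_Mcan m a a j Az) (along_delt a dN))).
have vert : \sum_(k < n) \sum_(b < p) Mcan h k b a z
      * along (ddv k b) (Ncan A h L g m a j) z
    = - (Chr_t h a a a z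
        * \sum_(k < n) along (ddv k a) (Ncan A h L g m a j) z * z.2 k a).
  rewrite mulr_sumr -sumrN; apply: eq_bigr => k _.
  by rewrite (sum_ord1 a)// /Mcan (sum_ord1 a)// mulNr mulrAC mulrA.
rewrite vert (sum_ord1 a)//.
move: (along _ _ _) (\sum_k _) (Chr_t _ _ _ _ _) (Ncan _ _ _ _ _ _ _ _).
by move=> *; ring.
Qed.

(** * Torsion in the adapted basis *)

Section Torsion.
Context (nabla : (E -> E) -> (E -> E) -> E -> E).
Hypothesis Cn : Cartan_connection A h L g nabla.

(** Assembling the three values as equations lets [bracket_horizontal] apply to [delt] and [delx],
    which are instances of [horizontal] by conversion. *)
Let torsionE X Y z u v w : nabla X Y z = u -> nabla Y X z = v ->
  bracket X Y z = w -> torsion nabla X Y z = u - v - w.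
Proof. by move=> <- <- <-. Qed.

Let dM a z (Az : A z) j b : differentiable (Mcan h j b a) z.
Proof. exact: smooth_on_differentiable (smooth_on_Mcan _ _ _) Az. Qed.

Let dN i z (Az : A z) j b : differentiable (Ncan A h L g j b i) z.
Proof. exact: smooth_on_differentiable (smooth_on_Ncan _ _ _) Az. Qed.

Let oppr_sum_ddv (x y : 'I_n -> 'I_p -> R) (z : E) :
  - \sum_(j < n) \sum_(b < p) (x j b - y j b) *: ddv j b z
  = \sum_(j < n) \sum_(b < p) (y j b - x j b) *: ddv j b z.
Proof.
rewrite -sumrN; apply: eq_bigr => j _; rewrite -sumrN; apply: eq_bigr => b _.
by rewrite -scaleNr opprB.
Qed.

(** The connection terms cancel by the symmetry of H, so the torsion is minus the bracket. *)
Lemma torsion_delt_delt a b z : A z ->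
  torsion nabla (delt h b) (delt h a) z
  = \sum_(m < n) \sum_(mu < p) (- \sum_(e < p) Curv_t h e mu a b z * z.2 m e)
      *: ddv m mu z.
Proof.
move=> Az; have [_ /(_ z Az) [[Ntt _ _] _ _]] := Cn.
apply: (eq_trans (torsionE (Ntt a b) (Ntt b a)
  (bracket_horizontal _ _ (dM b Az) (dM a Az)))).
have -> : \sum_(c < p) Chr_t h c b a z *: delt h c z
    = \sum_(c < p) Chr_t h c a b z *: delt h c z.
  apply: eq_bigr => c _; apply: (congr1 (fun x => x *: _)).
  exact: (christoffel_sym oA).
rewrite subrr sub0r oppr_sum_ddv.
apply: eq_bigr => m _; apply: eq_bigr => mu _.
exact: (congr1 (fun x => x *: _) (along_delt_Mcan m mu a b Az)).
Qed.

Lemma torsion_delx_delt a j z : A z ->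
  torsion nabla (delx A h L g j) (delt h a) z
  = \sum_(m < n) (- Gcf h g m j a z) *: delx A h L g m z
    + \sum_(m < n) \sum_(mu < p)
        (along (delx A h L g j) (Mcan h m mu a) z
         - along (delt h a) (Ncan A h L g m mu j) z) *: ddv m mu z.
Proof.
move=> Az; have [_ /(_ z Az) [[_ Ntx _] [Nxt _ _] _]] := Cn.
apply: (eq_trans (torsionE (Nxt j a) (Ntx j a)
  (bracket_horizontal _ _ (dN j Az) (dM a Az)))).
rewrite sub0r oppr_sum_ddv -sumrN; apply: (congr1 (fun x => x + _)).
by apply: eq_bigr => m _; rewrite scaleNr.
Qed.

Lemma torsion_delx_delx i j z : A z ->
  torsion nabla (delx A h L g j) (delx A h L g i) z
  = \sum_(m < n) \sum_(mu < p)
      (along (delx A h L g j) (Ncan A h L g m mu i) z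
       - along (delx A h L g i) (Ncan A h L g m mu j) z) *: ddv m mu z.
Proof.
move=> Az; have [_ /(_ z Az) [_ [_ Nxx _] _]] := Cn.
apply: (eq_trans (torsionE (Nxx i j) (Nxx j i)
  (bracket_horizontal _ _ (dN j Az) (dN i Az)))).
have -> : \sum_(k < n) Lcf A h L g k j i z *: delx A h L g k z
    = \sum_(k < n) Lcf A h L g k i j z *: delx A h L g k z.
  apply: eq_bigr => c _; apply: (congr1 (fun x => x *: _)).
  exact: (christoffel_sym oA).
by rewrite subrr sub0r oppr_sum_ddv.
Qed.

(** The bracket contributes the vertical derivative of M, a Christoffel symbol of [h]. It cancels
    the one in the connection coefficient of [ddv] along [delt], and only G survives. *)
Lemma torsion_ddv_delt a j b z : A z ->
  torsion nabla (ddv j b) (delt h a) z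
  = \sum_(m < n) \sum_(mu < p)
      (- ((b == mu)%:R * Gcf h g m j a z)) *: ddv m mu z.
Proof.
move=> Az; have [_ /(_ z Az) [[_ _ Ntv] _ [Nvt _ _]]] := Cn.
apply: (eq_trans (torsionE (Nvt j a b) (Ntv j b a)
  (bracket_ddv_horizontal j b _ (dM a Az)))).
rewrite sub0r opprK addrC -sumrB; apply: eq_bigr => m _.
rewrite -sumrB; apply: eq_bigr => mu _.
rewrite along_ddv_Mcan// -scalerBl; congr (_ *: _).
by rewrite opprB addKr.
Qed.

Lemma torsion_ddv_delx i j b z : A z ->
  torsion nabla (ddv j b) (delx A h L g i) z
  = \sum_(m < n) Ccf g m i b j z *: delx A h L g m z
    + \sum_(m < n) \sum_(mu < p)
        (along (ddv j b) (Ncan A h L g m mu i) z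
         - (mu == b)%:R * Lcf A h L g m j i z) *: ddv m mu z.
Proof.
move=> Az; have [_ /(_ z Az) [_ [_ _ Nxv] [_ Nvx _]]] := Cn.
apply: (eq_trans (torsionE (Nvx i j b) (Nxv j i b)
  (bracket_ddv_horizontal j b _ (dN i Az)))).
rewrite opprK -addrA; apply: (congr1 (fun x => _ + x)).
rewrite addrC -sumrB; apply: eq_bigr => m _.
under [RHS]eq_bigr do rewrite scalerBl.
rewrite sumrB; apply: (congr1 (fun x => _ - x)).
rewrite (bigD1 b)//= eqxx mul1r big1 ?addr0// => mu /negbTE ->.
by rewrite mul0r scale0r.
Qed.

Lemma torsion_ddv_ddv i j a b z : A z ->
  torsion nabla (ddv j b) (ddv i a) z
  = \sum_(m < n) Ccf g m i b j z *: ddv m a z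
    - \sum_(m < n) Ccf g m j a i z *: ddv m b z.
Proof.
move=> Az; have [_ /(_ z Az) [_ _ [_ _ Nvv]]] := Cn.
apply: (eq_trans (torsionE (Nvv i j a b) (Nvv j i b a)
  (bracket_ddv j b i a z))).
exact: subr0.
Qed.

Lemma torsion_one_time a z : p = 1%N -> A z ->
  [/\ torsion nabla (delt h a) (delt h a) z = 0,
      forall j, torsion nabla (delx A h L g j) (delt h a) z =
        \sum_(m < n) (- Gcf h g m j a z) *: delx A h L g m z
        + \sum_(m < n)
            (- along (ddt a) (Ncan A h L g m a j) z
             + Chr_t h a a a z * (Ncan A h L g m a j z
                 - \sum_(k < n) along (ddv k a) (Ncan A h L g m a j) z
                     * z.2 k a)) *: ddv m a z &
      [/\ forall i j, torsion nabla (delx A h L g j) (delx A h L g i) z =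
            \sum_(m < n) (along (delx A h L g j) (Ncan A h L g m a i) z
                - along (delx A h L g i) (Ncan A h L g m a j) z) *: ddv m a z,
          forall j, torsion nabla (ddv j a) (delt h a) z =
            \sum_(m < n) (- Gcf h g m j a z) *: ddv m a z,
          forall i j, torsion nabla (ddv j a) (delx A h L g i) z =
            \sum_(m < n) Ccf g m i a j z *: delx A h L g m z
            + \sum_(m < n) (along (ddv j a) (Ncan A h L g m a i) z
                - Lcf A h L g m j i z) *: ddv m a z &
          forall i j, torsion nabla (ddv j a) (ddv i a) z = 0]].
Proof.
move=> p1 Az; split; last split.
- by rewrite /torsion /bracket !subrr.
- move=> j; apply: (eq_trans (torsion_delx_delt a j Az)).
  apply: (congr1 (fun x => _ + x)); apply: eq_bigr => m _.
  rewrite (sum_ord1 a)//.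
  exact: (congr1 (fun x => x *: _) (mixed_coef_1 m a j p1 Az)).
- move=> i j; apply: (eq_trans (torsion_delx_delx i j Az)).
  by apply: eq_bigr => m _; rewrite (sum_ord1 a).
- move=> j; apply: (eq_trans (torsion_ddv_delt a j a Az)).
  by apply: eq_bigr => m _; rewrite (sum_ord1 a)// eqxx mul1r.
- move=> i j; apply: (eq_trans (torsion_ddv_delx i j a Az)).
  apply: (congr1 (fun x => _ + x)); apply: eq_bigr => m _.
  by rewrite (sum_ord1 a)// eqxx mul1r.
(* With a single time index both sums run over the same vectors [ddv m a], so the symmetry of C in
   its lower indices makes them equal. *)
- move=> i j; apply: (eq_trans (torsion_ddv_ddv i j a a Az)).
  apply/eqP; rewrite subr_eq0; apply/eqP; apply: eq_bigr => m _.
  apply: (congr1 (fun x => x *: _)); exact: (christoffel_sym oA).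
Qed.

Lemma torsion_several_times z : (1 < p)%N -> A z ->
  [/\ forall a b, torsion nabla (delt h b) (delt h a) z =
        \sum_(m < n) \sum_(mu < p)
          (- \sum_(e < p) Curv_t h e mu a b z * z.2 m e) *: ddv m mu z,
      forall a j, torsion nabla (delx A h L g j) (delt h a) z =
        \sum_(m < n) (- Gcf h g m j a z) *: delx A h L g m z
        + \sum_(m < n) \sum_(mu < p)
            (- along (ddt a) (Ncan A h L g m mu j) z
             + \sum_(k < n) \sum_(b < p)
                 invmx (g z) m k / 2 * Chr_t h b mu a z *
                 (along (ddt b) (fun w => g w j k) z
                  + \sum_(e < p) h z b e / 2 * Ucurl A h L g e k j z))
            *: ddv m mu z &
      [/\ forall i j, torsion nabla (delx A h L g j) (delx A h L g i) z =
            \sum_(m < n) \sum_(mu < p)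
              (\sum_(k < n) Curv_x g m k i j z * z.2 k mu
               + (Fcov A h L g m i mu j z - Fcov A h L g m j mu i z))
              *: ddv m mu z,
          forall a j b, torsion nabla (ddv j b) (delt h a) z =
            \sum_(m < n) \sum_(mu < p)
              (- ((b == mu)%:R * Gcf h g m j a z)) *: ddv m mu z,
          forall i j b, torsion nabla (ddv j b) (delx A h L g i) z = 0 &
          forall i j a b, torsion nabla (ddv j b) (ddv i a) z = 0]].
Proof.
move=> p_gt1 Az.
have C0 m i b j : Ccf g m i b j z = 0 by exact: Ccf_eq0.
split; last split.
- by move=> a b; exact: torsion_delt_delt.
- move=> a j; apply: (eq_trans (torsion_delx_delt a j Az)).
  apply: (congr1 (fun x => _ + x)).
  apply: eq_bigr => m _; apply: eq_bigr => mu _.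
  exact: (congr1 (fun x => x *: _) (mixed_coef_gt1 p_gt1 m mu a j Az)).
- move=> i j; apply: (eq_trans (torsion_delx_delx i j Az)).
  apply: eq_bigr => m _; apply: eq_bigr => mu _.
  exact: (congr1 (fun x => x *: _) (horizontal_coef_gt1 p_gt1 m mu i j Az)).
- by move=> a j b; exact: torsion_ddv_delt.
- move=> i j b; apply: (eq_trans (torsion_ddv_delx i j b Az)).
  rewrite big1 => [|m _]; last by rewrite C0 scale0r.
  rewrite add0r big1// => m _; rewrite big1// => mu _.
  (* The vertical derivative of N and L are the same Christoffel symbol of [g], up to the order of
     its lower indices. *)
  rewrite along_ddv_Ncan// Lcf_Chr_x// -mulrBr.
  have -> : Chr_x g m i j z = Chr_x g m j i z by exact: (christoffel_sym oA).
  by rewrite subrr mulr0 scale0r.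
- move=> i j a b; apply: (eq_trans (torsion_ddv_ddv i j a b Az)).
  by rewrite !big1 ?subrr// => m _; rewrite C0 scale0r.
Qed.

End Torsion.

End LocalLagrange.

(** * From the manifolds to the local hypotheses *)

Lemma has_index_unitmx (R : realType) m q (A : 'M[R]_m) :
  has_index q A -> A \in unitmx.
Proof.
case=> P uP ->; rewrite !unitmx_mul unitmx_tr uP andbT /=.
rewrite unitmxE det_diag unitfE; apply/prodf_neq0 => i _; rewrite mxE.
by case: ifP => _; rewrite ?oppr_eq0 oner_eq0.
Qed.

Lemma open_coord_dom (R : realType) m (X : smooth_manifold R m) (c : chart X) :
  open (Defs.coord c @` dom c).
Proof.
apply: coord_open => //.
have := @Defs.coord_continuous _ _ X c setT openT.
by rewrite preimage_setT setIT.
Qed.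

Lemma open_jet_range (R : realType) (p n : nat) (T : smooth_manifold R p)
  (M : smooth_manifold R n) (c : chart T) (d : chart M) : open (jet_range c d).
Proof.
have -> : jet_range c d = (fst \o fst) @^-1` (Defs.coord c @` dom c)
    `&` (snd \o fst) @^-1` (Defs.coord d @` dom d) by [].
by apply: openI; apply: open_comp; try exact: open_coord_dom; move=> z _;
  apply: continuous_comp; by [exact: cvg_fst|exact: cvg_snd].
Qed.

Lemma is_diff_base_point (R : realType) (p n : nat) (z : jet_coords R p n) :
  is_diff z (fun x : jet_coords R p n => x.1.1) (fun w => w.1.1).
Proof. exact: (is_diff_comp (is_diff_fst z) (is_diff_fst z.1)). Qed.

Theorem theorem4p4 (R : realType) (p n : nat) (hp : (0 < p)%N) (hn : (0 < n)%N)
    (T : smooth_manifold R p) (M : smooth_manifold R n)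
    (h : chart T -> 'rV[R]_p -> 'M[R]_p) (L : jet T M -> R)
    (g : chart T -> chart M -> jet_coords R p n -> 'M[R]_n)
    (hL : Lagrange_space h L g) (c : chart T) (d : chart M) :
  let A := jet_range c d in
  let h' := fun z : jet_coords R p n => h c z.1.1 in
  let L' := local_expr L c d in
  let g' := g c d in
  let y := fun (m : 'I_n) (a : 'I_p) (z : jet_coords R p n) => z.2 m a in
  let N := Ncan A h' L' g' in
  let H := Chr_t h' in
  let G := Gcf h' g' in
  let Lc := Lcf A h' L' g' in
  let C := Ccf g' in
  let dt := delt h' in
  let dx := delx A h' L' g' in
  let dv := @ddv R p n in
  let U := Ucurl A h' L' g' in
  let r := Curv_x g' in
  let K := Curv_t h' in
  let FF := Fcov A h' L' g' in
  forall nabla, Cartan_connection A h' L' g' nabla ->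
  let Tor := torsion nabla in
  (p = 1%N -> forall (a : 'I_p) (z : jet_coords R p n), A z ->
    [/\ Tor (dt a) (dt a) z = 0,
        forall j, Tor (dx j) (dt a) z =
          \sum_(m < n) (- G m j a z) *: dx m z
          + \sum_(m < n)
              (- along (ddt a) (N m a j) z
               + H a a a z *
                   (N m a j z
                    - \sum_(k < n) along (dv k a) (N m a j) z * y k a z))
              *: dv m a z &
        [/\ forall i j, Tor (dx j) (dx i) z =
              \sum_(m < n)
                (along (dx j) (N m a i) z - along (dx i) (N m a j) z)
                *: dv m a z,
            forall j, Tor (dv j a) (dt a) z =
              \sum_(m < n) (- G m j a z) *: dv m a z,
            forall i j, Tor (dv j a) (dx i) z =
              \sum_(m < n) C m i a j z *: dx m z
              + \sum_(m < n) (along (dv j a) (N m a i) z - Lc m j i z)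
                  *: dv m a z &
            forall i j, Tor (dv j a) (dv i a) z = 0]])
  /\
  ((2 <= p)%N -> forall z : jet_coords R p n, A z ->
    [/\ forall a b, Tor (dt b) (dt a) z =
          \sum_(m < n) \sum_(mu < p)
            (- \sum_(e < p) K e mu a b z * y m e z) *: dv m mu z,
        forall a j, Tor (dx j) (dt a) z =
          \sum_(m < n) (- G m j a z) *: dx m z
          + \sum_(m < n) \sum_(mu < p)
              (- along (ddt a) (N m mu j) z
               + \sum_(k < n) \sum_(b < p) invmx (g' z) m k / 2 * H b mu a z *
                   (along (ddt b) (fun w => g' w j k) z
                    + \sum_(e < p) h' z b e / 2 * U e k j z))
              *: dv m mu z &
        [/\ forall i j, Tor (dx j) (dx i) z =
              \sum_(m < n) \sum_(mu < p)
                (\sum_(k < n) r m k i j z * y k mu z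
                 + (FF m i mu j z - FF m j mu i z))
                *: dv m mu z,
            forall a j b, Tor (dv j b) (dt a) z =
              \sum_(m < n) \sum_(mu < p)
                (- ((b == mu)%:R * G m j a z)) *: dv m mu z,
            forall i j b, Tor (dv j b) (dx i) z = 0 &
            forall i j a b, Tor (dv j b) (dv i a) z = 0]]).
Proof.
move=> A h' L' g' y N H G Lc C dt dx dv U r K FF nabla Cn Tor.
have [[smooth_h sym_h [q index_h] _] smooth_L
  [smooth_g sym_g [q' index_g] _] KR] := hL.
have oA : open A by exact: open_jet_range.
(* The range of a jet chart restricts the base point only, so it contains whole fibres. *)
have fA (z : jet_coords R p n) u : A z -> A (z.1, u) by [].
have sh : smooth_on A h'.
  apply: (smooth_on_comp (@is_diff_base_point R p n)) (smooth_h c) => //.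
  by move=> z [].
have hT z : A z -> (h' z)^T = h' z.
  by case=> -[x cx xz] _; rewrite /h' -xz; exact: sym_h.
have uh z : A z -> h' z \in unitmx.
  by case=> -[x cx xz] _; rewrite /h' -xz; exact/has_index_unitmx/index_h.
have ug z : A z -> g' z \in unitmx by move=> Az; exact/has_index_unitmx/index_g.
have h_base (z w : jet_coords R p n) : w.1.1 = 0 -> h' (z + w) = h' z.
  by move=> w0; rewrite /h' /= w0 addr0.
split=> [p1 a z Az|p_gt1 z Az].
  exact: (torsion_one_time oA fA sh (smooth_L c d) (smooth_g c d) (sym_g c d)
    uh ug h_base (KR c d) Cn a p1 Az).
exact: (torsion_several_times oA fA sh (smooth_L c d) (smooth_g c d) hT
  (sym_g c d) uh ug h_base (KR c d) Cn p_gt1 Az).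
Qed.
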